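(* Let $L>0$, let $k\in\frac{2\pi}{L}(\mathbb{Z}\setminus\{0\})$, and let $f,g\in W^{2,\infty}([0,1])$ be real-valued with $0<c<g<c^{-1}<\infty$ for some constant $c$, and suppose that $f(0)\neq0$ and $f(1)\neq0$. Then for any $\omega_0\in H^2([0,1])$ with $\omega_0(0)\neq0$ and $\omega_0(1)\neq0$, the solution $W=W(t,y)$, with initial datum $W|_{t=0}=\omega_0$, of the linearized Euler equations at frequency $k$, $$\partial_tW=\frac{if(y)}{k}\Phi,\qquad\Big(-1+\Big(g(y)\big(\tfrac{\partial_y}{k}-it\big)\Big)^2\Big)\Phi=W,\qquad\Phi|_{y=0,1}=0,\qquad(t,y)\in\mathbb{R}\times[0,1],$$ satisfies $$\sup_{t\ge0}\|W(t)\|_{H^2([0,1])}=\infty.$$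
   Context: The operator $g(\frac{\partial_y}{k}-it)$ is $u\mapsto g\,(k^{-1}\partial_yu-itu)$, and its square is composition. The frequency $k$ (dual to $x\in\mathbb{T}_L$) is a fixed parameter: the linearized Euler equations decouple in $k$, and $W(t,\cdot)$ denotes the $k$-th Fourier mode of the scattered vorticity. *)

(* Defs.v *)
From HB Require Import structures.
From mathcomp Require Import all_boot all_order all_algebra.
From mathcomp Require Import all_classical all_reals all_analysis.
From mathcomp.real_closed Require Import complex.
Set Implicit Arguments.
Unset Strict Implicit.
Unset Printing Implicit Defensive.
Import Order.TTheory GRing.Theory Num.Theory.
Import numFieldNormedType.Exports.
Local Open Scope classical_set_scope.
Local Open Scope ring_scope.
Local Open Scope complex_scope.

(* Functions on [0, 1] are total functions on R of which only the restriction
   to [0, 1] matters. *)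
Section Sobolev.
Context {R : realType}.
Implicit Types (f g phi : R -> R) (u v : R -> R[i]).

Local Notation mu := (@lebesgue_measure R).
Local Notation I01 := `[0%R : R, 1%R : R]%classic.

Definition C1c phi : Prop :=
  [/\ forall x, derivable phi x 1,
      continuous (derive1 phi) &
      exists a b : R, [/\ 0 < a, b < 1 & forall x, x \notin `[a, b] -> phi x = 0]].

(* [g] is the weak derivative of [f] on (0, 1), both being in L^1(0, 1).
   Test functions are C^1 with compact support in (0, 1), as is usual in one
   dimension; C^infty test functions define the same relation. *)
Definition weak_deriv f g : Prop :=
  [/\ mu.-integrable I01 (EFin \o f),
      mu.-integrable I01 (EFin \o g) &
      forall phi, C1c phi ->
        (\int[mu]_(y in I01) (f y * derive1 phi y) =
         - \int[mu]_(y in I01) (g y * phi y))%R].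

Definition Linfty f : Prop :=
  measurable_fun I01 f /\
  exists M : R, {ae mu, forall y, I01 y -> `|f y| <= M}.

(* An element of W^{2,infty}, given by its continuous representative, so that
   point values make sense. *)
Definition W2infty f : Prop :=
  {within I01, continuous f} /\
  exists f1 f2, [/\ Linfty f, Linfty f1, Linfty f2,
                    weak_deriv f f1 & weak_deriv f1 f2].

Definition sqL2norm u : \bar R :=
  (\int[mu]_(y in I01) (Normc.normc (u y) ^+ 2)%:E)%E.

Definition L2norm u : \bar R := poweR (sqL2norm u) 2^-1.

Definition L2 u : Prop :=
  [/\ measurable_fun I01 (fun y => complex.Re (u y)),
      measurable_fun I01 (fun y => complex.Im (u y)) &
      (L2norm u < +oo)%E].

Definition cweak_deriv u v : Prop :=
  weak_deriv (fun y => complex.Re (u y)) (fun y => complex.Re (v y)) /\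
  weak_deriv (fun y => complex.Im (u y)) (fun y => complex.Im (v y)).

Definition ccontinuous01 u : Prop :=
  {within I01, continuous (fun y => complex.Re (u y))} /\
  {within I01, continuous (fun y => complex.Im (u y))}.

Definition H2_derivs u u1 u2 : Prop :=
  [/\ L2 u, L2 u1, L2 u2, cweak_deriv u u1 & cweak_deriv u1 u2].

(* Weak derivatives are unique a.e., so the infimum ranges over one value, the
   H^2 norm, if [u] is in H^2, and over the empty set otherwise, giving +oo. *)
Definition H2norm u : \bar R :=
  ereal_inf [set N | exists u1 u2, H2_derivs u u1 u2 /\
    N = poweR (sqL2norm u + sqL2norm u1 + sqL2norm u2)%E 2^-1].

(* An element of H^2, given by its continuous representative. *)
Definition H2 u : Prop :=
  ccontinuous01 u /\ exists u1 u2, H2_derivs u u1 u2.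

(* g (d_y / k - i t) u, where [u1] is the weak derivative of [u] *)
Definition shear_op g (k t : R) u u1 : R -> R[i] :=
  fun y => (g y)%:C * (k^-1%:C * u1 y - 'i%C * t%:C * u y).

(* Phi is in H^1_0 and g (d_y / k - i t) Phi in H^1 (equivalently Phi in H^2, for
   g in W^{2,infty} bounded below), the square is composition, and the equation
   holds in L^2. *)
Definition stream_function g (k t : R) (w Phi : R -> R[i]) : Prop :=
  [/\ ccontinuous01 Phi, Phi 0 = 0, Phi 1 = 0 &
      exists Phi1 v1, let v := shear_op g k t Phi Phi1 in
        [/\ L2 Phi, L2 Phi1, cweak_deriv Phi Phi1,
            L2 v /\ L2 v1 /\ cweak_deriv v v1 &
            {ae mu, forall y, I01 y ->
               - Phi y + shear_op g k t v v1 y = w y}]].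

(* Solutions are understood as differentiable curves in L^2(0, 1): the map
   W(t) |-> Phi(t) is bounded on L^2, so that the system is a linear ordinary
   differential equation there. *)
Definition euler_solution f g (k : R) (w0 : R -> R[i]) (W : R -> R -> R[i])
    : Prop :=
  [/\ forall t, L2 (W t),
      {ae mu, forall y, I01 y -> W 0 y = w0 y} &
      exists Phi : R -> R -> R[i], forall t,
        stream_function g k t (W t) (Phi t) /\
        L2norm (fun y => h^-1%:C * (W (t + h) y - W t y)
                         - 'i%C * (f y)%:C / k%:C * Phi t y)
          @[h --> 0^'] --> 0%E].

End Sobolev.

(* Main.v *)
Require Import Defs.
From HB Require Import structures.
From mathcomp Require Import all_boot all_order all_algebra.
From mathcomp Require Import all_classical all_reals all_analysis.
From mathcomp.real_closed Require Import complex.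
From mathcomp Require Import measurable_realfun ring lra.
Import Order.TTheory GRing.Theory Num.Theory.
Import numFieldNormedType.Exports.
Local Open Scope classical_set_scope.
Local Open Scope ring_scope.
Local Open Scope complex_scope.

Set Implicit Arguments.
Unset Strict Implicit.
Unset Printing Implicit Defensive.

(** In the moving frame [Phi = exp (i k t y) P] the elliptic equation becomes
    the first order system [P' = r X], [X' = r (P + V)] with [r = k / g],
    [V = exp (- i k t y) W] and [P = 0] at both ends ([mode_rot]). It does not
    depend on time, and its homogeneous solutions are exponentials of the
    primitive [s] of [r].

    Suppose that [W] stays bounded in H^2 for [t >= 0], so that
    [W t] is Lipschitz on [0, 1] uniformly in [t]. Since [Phi] vanishes at [0],
    the boundary value [W t 0] is conserved ([trace_conserved]). Testing the
    system with the homogeneous solution that vanishes at [1] writes [X 0] as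
    the integral of [V] against a fixed weight ([stream_boundary]). In this
    oscillatory integral two integrations by parts leave a boundary term
    at [y = 0] only, whence [X 0 = i W 0 0 / (g 0 t) + O(t ^ -2)]
    ([boundary_velocity]), and [Phi t y] is equal to [exp (i k t y) r 0 X 0 y]
    up to [O(y ^ 2)], uniformly in [t] ([stream_bound], [mode_bound]).
    The equation for [W] then says that the derivative of [W t y] in time is
    [- f 0 W 0 0 y / (g 0 ^ 2 t)] to leading order: the slope of [W t] at [0]
    grows like [ln t], which contradicts the uniform Lipschitz bound
    ([no_bounded_evolution]).

    The solution is only a curve in L^2, so the slope at [0] is read off from
    the integral of [W t] over [0, h] at scale [h ^ 2], with [h] sent to [0]
    for each fixed time. All estimates are carried out on the real and imaginary
    parts of the continuous representatives of the functions involved; these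
    are absolutely continuous by the lemma of du Bois-Reymond
    ([weak_deriv_ac]). *)

(** * Integrals over subintervals of the unit interval *)

Section UnitInterval.
Context {R : realType}.
Implicit Types (f g F G : R -> R) (a b c x y : R).
Local Notation mu := (@lebesgue_measure R).
Local Notation I01 := `[0%R : R, 1%R : R]%classic.

Definition L1 f : Prop := mu.-integrable I01 (EFin \o f).

Definition itg a b f : R := \int[mu]_(x in `[a, b]) f x.

Lemma mI01 : measurable I01.
Proof. exact: measurable_itv. Qed.

Lemma L1S a b f : 0 <= a -> b <= 1 -> L1 f ->
  mu.-integrable `[a, b] (EFin \o f).
Proof.
move=> a0 b1; apply: integrableS; [exact: measurable_itv..|].
by apply: subset_itv; rewrite bnd_simp.
Qed.

Lemma L1_measurable f : L1 f -> measurable_fun I01 f.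
Proof. by move=> /measurable_int /measurable_EFinP. Qed.

Lemma L1D f g : L1 f -> L1 g -> L1 (fun x => f x + g x).
Proof. by move=> If Ig; have := @integrableD _ _ _ mu _ mI01 _ _ If Ig. Qed.

Lemma L1Z c f : L1 f -> L1 (fun x => c * f x).
Proof. by move=> If; have := @integrableZl _ _ _ mu _ mI01 c _ If. Qed.

Lemma L1N f : L1 f -> L1 (fun x => - f x).
Proof. by move=> If; have := @integrableN _ _ _ mu _ _ If. Qed.

Lemma L1B f g : L1 f -> L1 g -> L1 (fun x => f x - g x).
Proof. by move=> If Ig; have := L1D If (L1N Ig). Qed.

Lemma L1_norm f : L1 f -> L1 (fun x => `|f x|).
Proof. exact: integrable_norm. Qed.

Lemma L1_cst c : L1 (fun=> c).
Proof.
apply: measurable_bounded_integrable => //.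
- by rewrite /= lebesgue_measure_itv/= lte_fin ltr01 EFinN sube0 ltry.
- by exists `|c|; split; [exact: num_real|move=> M cM x _ /=; exact: ltW].
Qed.

Lemma L1_bounded c f : measurable_fun I01 f ->
  (forall x, 0 <= x <= 1 -> `|f x| <= c) -> L1 f.
Proof.
move=> mf fc.
apply: (@le_integrable _ _ _ mu _ mI01 _ _ _ _ (L1_cst c)); first exact/measurable_EFinP.
move=> x /=; rewrite in_itv/= => xI; rewrite lee_fin.
by rewrite (le_trans (fc _ xI))// ler_norm.
Qed.

Lemma L1M f g c : measurable_fun I01 f ->
  (forall x, 0 <= x <= 1 -> `|f x| <= c) -> L1 g -> L1 (fun x => f x * g x).
Proof.
move=> mf fc Ig.
apply: (@le_integrable _ _ _ mu _ mI01 _ _ _ _ (L1Z c Ig)).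
  apply/measurable_EFinP; apply: measurable_funM => //.
  exact: L1_measurable.
move=> x /=; rewrite in_itv/= => xI; rewrite lee_fin !normrM.
by rewrite ler_wpM2r// (le_trans (fc _ xI))// ler_norm.
Qed.

Lemma L1_ae f g : L1 f -> measurable_fun I01 g ->
  {ae mu, forall y, I01 y -> f y = g y} -> L1 g.
Proof.
move=> If mg fg; have mf := L1_measurable If.
apply/integrableP; split; first exact/measurable_EFinP.
have /integrableP[_] := If.
rewrite (@ae_eq_integral _ _ _ mu I01 (fun x => `|(EFin \o f) x|)%E
  (fun x => `|(EFin \o g) x|)%E)//=.
- by apply/measurable_EFinP; apply: measurableT_comp.
- by apply/measurable_EFinP; apply: measurableT_comp.
- by apply: (@filterS _ _ (ae_filter_ringOfSetsType mu) _ _ _ fg) => x /= + xI => ->.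
Qed.

Lemma itgaa a f : itg a a f = 0.
Proof. by rewrite /itg set_itv1 Rintegral_set1. Qed.

Lemma itg_split b a c f : 0 <= a -> a <= b -> b <= c -> c <= 1 -> L1 f ->
  itg a c f = itg a b f + itg b c f.
Proof.
move=> a0 ab bc c1 If.
have Iac : mu.-integrable `[a, c] (EFin \o f) by exact: L1S.
have := @Rintegral_itvB _ f (BLeft a) (BRight c) b Iac.
rewrite !bnd_simp => /(_ ab bc) /=.
rewrite Rintegral_itv_obnd_cbnd; last first.
  by apply: integrableS Iac => //; apply: subset_itvr; rewrite bnd_simp.
by rewrite /itg => <-; rewrite addrC subrK.
Qed.

Lemma itgB a b f g : 0 <= a -> b <= 1 -> L1 f -> L1 g ->
  itg a b (fun x => f x - g x) = itg a b f - itg a b g.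
Proof. by move=> a0 b1 If Ig; apply: RintegralB => //; exact: L1S. Qed.

Lemma itgD a b f g : 0 <= a -> b <= 1 -> L1 f -> L1 g ->
  itg a b (fun x => f x + g x) = itg a b f + itg a b g.
Proof. by move=> a0 b1 If Ig; apply: RintegralD => //; exact: L1S. Qed.

Lemma itgZ a b c f : 0 <= a -> b <= 1 -> L1 f ->
  itg a b (fun x => c * f x) = c * itg a b f.
Proof. by move=> a0 b1 If; apply: RintegralZl => //; exact: L1S. Qed.

Lemma itgN a b f : 0 <= a -> b <= 1 -> L1 f ->
  itg a b (fun x => - f x) = - itg a b f.
Proof.
move=> a0 b1 If; rewrite -mulN1r -itgZ//.
by apply: eq_Rintegral => x _; rewrite mulN1r.
Qed.

Lemma itg_cst a b c : a <= b -> itg a b (fun=> c) = c * (b - a).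
Proof.
move=> ab; rewrite /itg Rintegral_cst//= lebesgue_measure_itv/= lte_fin.
move: ab; rewrite le_eqVlt => /predU1P[->|->//].
by rewrite ltxx subrr.
Qed.

Lemma le_itg a b f g : 0 <= a -> b <= 1 -> L1 f -> L1 g ->
  (forall x, a <= x <= b -> f x <= g x) -> itg a b f <= itg a b g.
Proof.
move=> a0 b1 If Ig fg; apply: le_Rintegral; [by []|exact: L1S|exact: L1S|].
by move=> x /=; rewrite in_itv/=; exact: fg.
Qed.

Lemma eq_itg a b f g : (forall x, a <= x <= b -> f x = g x) ->
  itg a b f = itg a b g.
Proof.
by move=> fg; apply: eq_Rintegral => x; rewrite inE/= in_itv/=; exact: fg.
Qed.

Lemma itg_ge0 a b f : (forall x, a <= x <= b -> 0 <= f x) -> 0 <= itg a b f.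
Proof.
by move=> fg; apply: Rintegral_ge0 => x /=; rewrite in_itv/=; exact: fg.
Qed.

Lemma norm_itg_le a b f g : 0 <= a -> b <= 1 -> L1 f -> L1 g ->
  (forall x, a <= x <= b -> `|f x| <= g x) -> `|itg a b f| <= itg a b g.
Proof.
move=> a0 b1 If Ig fg.
rewrite (@le_trans _ _ (itg a b (fun x => `|f x|)))//.
  by apply: le_normr_Rintegral => //; exact: L1S.
by apply: le_itg => //; exact: L1_norm.
Qed.

Lemma norm_itg_cst a b c f : 0 <= a -> a <= b -> b <= 1 -> L1 f ->
  (forall x, a <= x <= b -> `|f x| <= c) -> `|itg a b f| <= c * (b - a).
Proof.
move=> a0 ab b1 If fc; rewrite -itg_cst//.
by apply: norm_itg_le => //; exact: L1_cst.
Qed.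

Lemma norm_itg_full a b f : 0 <= a -> a <= b -> b <= 1 -> L1 f ->
  `|itg a b f| <= itg 0 1 (fun x => `|f x|).
Proof.
move=> a0 ab b1 If; have If' := L1_norm If.
apply: (@le_trans _ _ (itg a b (fun x => `|f x|))); first exact: norm_itg_le.
rewrite (@itg_split a 0 1)// 1?(le_trans ab)// (@itg_split b a 1)//.
by rewrite addrCA lerDl addr_ge0//; apply: itg_ge0.
Qed.

Lemma eq_itg_ae a b f g : 0 <= a -> b <= 1 ->
  measurable_fun I01 f -> measurable_fun I01 g ->
  {ae mu, forall y, I01 y -> f y = g y} -> itg a b f = itg a b g.
Proof.
move=> a0 b1 mf mg fg.
have sub : `[a, b] `<=` I01 by apply: subset_itv; rewrite bnd_simp.
rewrite /itg /Rintegral; congr fine; apply: ae_eq_integral => //.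
- by apply/measurable_EFinP; exact: measurable_funS mf.
- by apply/measurable_EFinP; exact: measurable_funS mg.
- by apply: (@filterS _ _ (ae_filter_ringOfSetsType mu) _ _ _ fg) => x /= + xI => -> //; exact: sub.
Qed.

End UnitInterval.

(** * Absolutely continuous functions on the unit interval *)

Section AbsolutelyContinuous.
Context {R : realType}.
Implicit Types (f g F G : R -> R) (a b c x y : R).
Local Notation mu := (@lebesgue_measure R).
Local Notation I01 := `[0%R : R, 1%R : R]%classic.

(** [F] is absolutely continuous on [0, 1] with derivative [f]. The derivative is
    carried along because it is only determined almost everywhere, and values
    of [F] outside [0, 1] are left free. *)
Definition ac F f : Prop :=
  L1 f /\ forall y, 0 <= y <= 1 -> F y = F 0 + itg 0 y f.

Lemma itg0_cont f : L1 f -> {within I01, continuous (fun y => itg 0 y f)}.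
Proof. by move=> If; exact: (@parameterized_integral_continuous R 0 1 f ler01 If). Qed.

Lemma ac_incr F f a b : ac F f -> 0 <= a -> a <= b -> b <= 1 ->
  F b - F a = itg a b f.
Proof.
move=> [If E] a0 ab b1.
rewrite (E b) ?(E a) ?a0 ?b1 ?(le_trans a0)// ?(le_trans ab)//.
by rewrite (@itg_split _ a 0 b)//; ring.
Qed.

Lemma ac_cont F f : ac F f -> {within I01, continuous F}.
Proof.
move=> [If E].
apply: (@subspace_eq_continuous _ _ _ (fun y => F 0 + itg 0 y f)).
  by move=> y; rewrite inE/= in_itv/= => yI; rewrite -E.
by move=> y; apply: cvgD; [exact: cvg_cst|exact: itg0_cont].
Qed.

Lemma ac_measurable F f : ac F f -> measurable_fun I01 F.
Proof.
move=> /ac_cont cF; apply: subspace_continuous_measurable_fun => //.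
Qed.

Lemma ac_dist F f a b : ac F f -> 0 <= a <= 1 -> 0 <= b <= 1 ->
  `|F b - F a| <= itg 0 1 (fun x => `|f x|).
Proof.
move=> acF; wlog ab : a b / a <= b => [th|] aI bI.
  by case: (leP a b) => [|/ltW] ab; [|rewrite distrC]; exact: th.
case/andP: aI bI => a0 _ /andP[_ b1]; case: (acF) => If _.
by rewrite (ac_incr acF)// norm_itg_full.
Qed.

Lemma ac_bounded F f : ac F f ->
  exists2 c, 0 <= c & forall y, 0 <= y <= 1 -> `|F y| <= c.
Proof.
move=> acF; exists (`|F 0| + itg 0 1 (fun x => `|f x|)).
  by rewrite addr_ge0// itg_ge0.
move=> y yI; rewrite -{1}(subrK (F 0) (F y)) addrC (le_trans (ler_normD _ _))//.
by rewrite lerD2l (ac_dist acF)// lexx ler01.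
Qed.

Lemma ac_L1 F f : ac F f -> L1 F.
Proof.
move=> acF; have [c _ Fc] := ac_bounded acF.
by apply: L1_bounded Fc; exact: ac_measurable acF.
Qed.

Lemma acML1 F f g : ac F f -> L1 g -> L1 (fun x => F x * g x).
Proof.
move=> acF; have [c _ Fc] := ac_bounded acF.
by apply: L1M Fc; exact: ac_measurable acF.
Qed.

Lemma acL1M F f g : ac F f -> L1 g -> L1 (fun x => g x * F x).
Proof.
move=> acF Ig; have := acML1 acF Ig.
by congr L1; apply/funext => x; rewrite mulrC.
Qed.

Lemma ac_eq F G f g : (forall x, 0 <= x <= 1 -> F x = G x) -> f =1 g ->
  ac F f -> ac G g.
Proof.
move=> FG /funext <- [If E]; split => // y yI.
by rewrite -!FG ?lexx ?ler01//; exact: E.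
Qed.

Lemma ac_eq_ae F f g : measurable_fun I01 g ->
  {ae mu, forall y, I01 y -> f y = g y} -> ac F f -> ac F g.
Proof.
move=> mg fg [If E]; split; first exact: L1_ae fg.
move=> y /andP[y0 y1]; rewrite E ?y0//; congr (_ + _).
by apply: eq_itg_ae => //; exact: L1_measurable.
Qed.

Lemma ac_cst c : ac (fun=> c) (fun=> 0).
Proof.
split=> [|y /andP[y0 y1]]; first exact: L1_cst.
by rewrite itg_cst// mul0r addr0.
Qed.

Lemma acD F G f g : ac F f -> ac G g ->
  ac (fun x => F x + G x) (fun x => f x + g x).
Proof.
move=> [If EF] [Ig EG]; split=> [|y yI]; first exact: L1D.
by case/andP: (yI) => y0 y1; rewrite itgD// EF// EG//; ring.
Qed.

Lemma acZ c F f : ac F f -> ac (fun x => c * F x) (fun x => c * f x).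
Proof.
move=> [If EF]; split=> [|y yI]; first exact: L1Z.
by case/andP: (yI) => y0 y1; rewrite itgZ// EF// mulrDr.
Qed.

Lemma acB F G f g : ac F f -> ac G g ->
  ac (fun x => F x - G x) (fun x => f x - g x).
Proof.
move=> aF aG; have := acD aF (acZ (-1) aG).
by apply: ac_eq => [x _|x]; ring.
Qed.

(** Cutting an interval at a point where [N] takes the mean of its values at the
    ends gains a factor [2] in the bound on the increment of [D]; after [n] cuts
    the factor is [2 ^ n]. *)
Lemma quadratic_increments (D N : R -> R) (K : R) :
  {within I01, continuous N} ->
  (forall a b, 0 <= a -> a <= b -> b <= 1 -> N a <= N b) ->
  (forall a b, 0 <= a -> a <= b -> b <= 1 ->
     `|D b - D a| <= K * (N b - N a) ^+ 2) ->
  forall y, 0 <= y <= 1 -> D y = D 0.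
Proof.
move=> cN ndN DN y /andP[y0 y1].
have {}DN n a b : 0 <= a -> a <= b -> b <= 1 ->
    `|D b - D a| * (2 ^ n)%:R <= K * (N b - N a) ^+ 2.
  elim: n a b => [a b a0 ab b1|n IH a b a0 ab b1]; first by rewrite mulr1 DN.
  have [||m] := @IVT R N a b ((N a + N b) / 2) ab.
  - by apply: continuous_subspaceW cN; apply: subset_itv; rewrite bnd_simp.
  - by have := ndN _ _ a0 ab b1 => Nab; rewrite min_l// max_r//; lra.
  rewrite in_itv/= => /andP[am mb] Nm.
  have H1 := IH a m a0 am (le_trans mb b1).
  have H2 := IH m b (le_trans a0 am) mb b1.
  have E1 : K * (N m - N a) ^+ 2 = K * (N b - N a) ^+ 2 / 4 by rewrite Nm; field.
  have E2 : K * (N b - N m) ^+ 2 = K * (N b - N a) ^+ 2 / 4 by rewrite Nm; field.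
  rewrite expnS natrM.
  have H3 : `|D b - D a| <= `|D b - D m| + `|D m - D a|.
    by rewrite (le_trans _ (ler_normD _ _))// addrA subrK.
  have P : 0 <= (2 ^ n)%:R :> R by [].
  have := ler_wpM2r P H3; rewrite mulrDl; lra.
apply/eqP; rewrite -subr_eq0 -normr_eq0; apply/negP => /negP D0.
have {}D0 : 0 < `|D y - D 0| by rewrite lt_def D0 normr_ge0.
set c := K * (N y - N 0) ^+ 2 / `|D y - D 0|.
have cle n : (2 ^ n)%:R <= c by rewrite ler_pdivlMr// mulrC; exact: DN.
have c0 : 0 <= c by exact: le_trans (cle 0%N).
have := archi_boundP c0; rewrite ltNge => /negP; apply.
by rewrite (le_trans _ (cle (Num.bound c)))// ler_nat ltnW// ltn_expl.
Qed.

(** The common reason behind the product and chain rules: a candidate derivative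
    needs to be correct only up to a quadratic error on each subinterval. *)
Lemma ac_quadratic F (h n : R -> R) (K : R) : L1 h -> L1 n -> (forall y, 0 <= n y) ->
  (forall a b, 0 <= a -> a <= b -> b <= 1 ->
     `|F b - F a - itg a b h| <= K * (itg a b n) ^+ 2) -> ac F h.
Proof.
move=> Ih In n0 FK; split=> // y yI.
pose N y := itg 0 y n.
have NE a b : 0 <= a -> a <= b -> b <= 1 -> N b - N a = itg a b n.
  by move=> a0 ab b1; rewrite /N (@itg_split _ a 0 b)//; ring.
have := @quadratic_increments (fun y => F y - itg 0 y h) N K.
move=> /(_ (itg0_cont In)) H.
have : F y - itg 0 y h = F 0 - itg 0 0 h.
  apply: H => // a b a0 ab b1.
    by rewrite -subr_ge0 NE// itg_ge0.
  rewrite NE// (@itg_split _ a 0 b)//.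
  rewrite (_ : _ - _ = F b - F a - itg a b h); first exact: FK.
  by ring.
by rewrite itgaa subr0 => /eqP; rewrite subr_eq => /eqP.
Qed.

Lemma acM F G f g : ac F f -> ac G g ->
  ac (fun x => F x * G x) (fun x => f x * G x + F x * g x).
Proof.
move=> aF aG; have [If _] := aF; have [Ig _] := aG.
have IfG := acL1M aG If; have IFg := acML1 aF Ig.
apply: (@ac_quadratic _ _ (fun x => `|f x| + `|g x|) 1).
- exact: L1D.
- by apply: L1D; exact: L1_norm.
- by move=> y; rewrite addr_ge0.
move=> a b a0 ab b1.
have b0 := le_trans a0 ab; have a1 := le_trans ab b1.
set A := itg a b (fun x => `|f x|); set B := itg a b (fun x => `|g x|).
have A0 : 0 <= A by apply: itg_ge0.
have B0 : 0 <= B by apply: itg_ge0.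
have IGf : L1 (fun x => G b * f x - f x * G x) by apply: L1B => //; exact: L1Z.
have IFa : L1 (fun x => F a * g x - F x * g x) by apply: L1B => //; exact: L1Z.
have E : F b * G b - F a * G a - itg a b (fun x => f x * G x + F x * g x)
    = itg a b (fun x => G b * f x - f x * G x)
    + itg a b (fun x => F a * g x - F x * g x).
  rewrite itgD// !itgB ?itgZ//; try exact: L1Z.
  by rewrite -(ac_incr aF)// -(ac_incr aG)//; ring.
have H1 : `|itg a b (fun x => G b * f x - f x * G x)| <= B * A.
  rewrite /A -itgZ//; last exact: L1_norm.
  apply: norm_itg_le => //; first by apply: L1Z; exact: L1_norm.
  move=> x /andP[ax xb].
  rewrite [X in `|X|](_ : _ = (G b - G x) * f x); last by ring.
  rewrite normrM ler_wpM2r// (ac_incr aG)//; last exact: le_trans ax.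
  rewrite (@le_trans _ _ (itg x b (fun x => `|g x|)))//.
    by apply: norm_itg_le => //; [exact: le_trans ax|exact: L1_norm].
  rewrite /B (@itg_split _ x a b)//; last exact: L1_norm.
  by rewrite lerDr itg_ge0.
have H2 : `|itg a b (fun x => F a * g x - F x * g x)| <= A * B.
  rewrite /B -itgZ//; last exact: L1_norm.
  apply: norm_itg_le => //; first by apply: L1Z; exact: L1_norm.
  move=> x /andP[ax xb].
  rewrite -mulrBl normrM ler_wpM2r// distrC (ac_incr aF)//; last exact: le_trans b1.
  rewrite (@le_trans _ _ (itg a x (fun x => `|f x|)))//.
    by apply: norm_itg_le => //; [exact: le_trans b1|exact: L1_norm].
  rewrite /A (@itg_split _ x a b)//; last exact: L1_norm.
  by rewrite lerDl itg_ge0.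
have EAB : itg a b (fun x => `|f x| + `|g x|) = A + B.
  by rewrite itgD//; exact: L1_norm.
rewrite E EAB mul1r (le_trans (ler_normD _ _))// (le_trans (lerD H1 H2))//.
have := mulr_ge0 A0 B0; have := sqr_ge0 A; have := sqr_ge0 B; nra.
Qed.

(** Chain rule, for an outer function whose first order Taylor expansion has a
    quadratic remainder on the range of [F]. *)
Lemma ac_comp (h h' : R -> R) K F f : 0 <= K -> ac F f ->
  measurable_fun I01 (h' \o F) ->
  (forall x y, 0 <= x <= 1 -> 0 <= y <= 1 ->
    `|h (F y) - h (F x) - h' (F x) * (F y - F x)| <= K * (F y - F x) ^+ 2) ->
  (forall x y, 0 <= x <= 1 -> 0 <= y <= 1 ->
    `|h' (F y) - h' (F x)| <= K * `|F y - F x|) ->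
  ac (fun x => h (F x)) (fun x => h' (F x) * f x).
Proof.
move=> K0 aF mh' hT hL; have [If _] := aF.
have [c _ Fc] := ac_bounded aF.
have Ih : L1 (fun x => h' (F x) * f x).
  apply: (@L1M _ (h' \o F) _ (`|h' (F 0)| + K * (c + c))) => // x xI /=.
  have I0 : 0 <= (0 : R) <= 1 by rewrite lexx ler01.
  rewrite -{1}(subrK (h' (F 0)) (h' (F x))) addrC (le_trans (ler_normD _ _))//.
  rewrite lerD2l (le_trans (hL _ _ I0 xI))//.
  rewrite ler_wpM2l//.
  by rewrite (le_trans (ler_normB _ _))// lerD// Fc.
apply: (@ac_quadratic _ _ (fun x => `|f x|) (K + K)) => //.
  exact: L1_norm.
move=> a b a0 ab b1.
have b0 := le_trans a0 ab; have a1 := le_trans ab b1.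
have aI : 0 <= a <= 1 by rewrite a0.
have bI : 0 <= b <= 1 by rewrite b0.
set A := itg a b (fun x => `|f x|).
have A0 : 0 <= A by apply: itg_ge0.
have FA x : a <= x <= b -> `|F x - F a| <= A.
  move=> /andP[ax xb]; rewrite (ac_incr aF)//; last exact: le_trans b1.
  rewrite (@le_trans _ _ (itg a x (fun x => `|f x|)))//.
    by apply: norm_itg_le => //; [exact: le_trans b1|exact: L1_norm].
  rewrite /A (@itg_split _ x a b)//; last exact: L1_norm.
  by rewrite lerDl itg_ge0.
have E : h (F b) - h (F a) - itg a b (fun x => h' (F x) * f x) =
    (h (F b) - h (F a) - h' (F a) * (F b - F a))
    + itg a b (fun x => h' (F a) * f x - h' (F x) * f x).
  by rewrite itgB ?itgZ//; [rewrite -(ac_incr aF)//; ring|exact: L1Z].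
have H1 : `|itg a b (fun x => h' (F a) * f x - h' (F x) * f x)| <= K * A * A.
  rewrite -[leRHS]itgZ//; last exact: L1_norm.
  apply: norm_itg_le => //.
  - by apply: L1B => //; exact: L1Z.
  - by apply: L1Z; exact: L1_norm.
  move=> x xab; have [ax xb] := andP xab.
  have xI : 0 <= x <= 1 by rewrite (le_trans a0)// (le_trans xb).
  rewrite -mulrBl normrM ler_wpM2r// distrC (le_trans (hL _ _ aI xI))//.
  by rewrite ler_wpM2l// FA.
rewrite E (le_trans (ler_normD _ _))// mulrDl lerD//; last first.
  by rewrite expr2 mulrA.
rewrite (le_trans (hT _ _ aI bI))// ler_wpM2l// -(ger0_norm (sqr_ge0 _)).
by rewrite normrX ler_sqr ?nnegrE// FA// ab lexx.
Qed.

End AbsolutelyContinuous.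

(** * Functions with a weak derivative are absolutely continuous *)

Section WeakDerivative.
Context {R : realType}.
Implicit Types (f g F G : R -> R) (a b c d x y : R).
Local Notation mu := (@lebesgue_measure R).
Local Notation I01 := `[0%R : R, 1%R : R]%classic.

Lemma ac_id : ac (fun x : R => x) (fun=> 1).
Proof.
split=> [|y /andP[y0 y1]]; first exact: L1_cst.
by rewrite itg_cst// mul1r subr0 add0r.
Qed.

Lemma is_derive_quotient F x l :
  h^-1 * (F (x + h) - F x) @[h --> 0^'] --> l -> is_derive x 1 F l.
Proof.
move=> Fl.
have E : (fun h => h^-1 *: ((F \o shift x) (h *: 1) - F x)) =
         (fun h => h^-1 * (F (x + h) - F x)).
  by apply/funext => h; rewrite /= [h *: 1]mulr1 [h + x]addrC.
apply: DeriveDef; first by rewrite /derivable E; apply/cvg_ex; exists l.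
by rewrite /derive E; apply/cvg_lim.
Qed.

Lemma is_derive_quadratic F K x l :
  (forall y, `|F y - F x - l * (y - x)| <= K * (y - x) ^+ 2) ->
  is_derive x 1 F l.
Proof.
move=> FK; apply: is_derive_quotient; apply/cvgrPdist_le => e e0.
have K1 : 0 < `|K| + 1 by rewrite ltr_wpDl.
near=> h.
have h0 : h != 0 by near: h; exact: nbhs_dnbhs_neq.
rewrite -(ler_pM2l (_ : 0 < `|h|)) ?normr_gt0// -normrM.
rewrite (_ : h * _ = - (F (x + h) - F x - l * (x + h - x))); last by field.
rewrite normrN (le_trans (FK _))// (_ : x + h - x = h); last by ring.
rewrite -(ger0_norm (sqr_ge0 h)) normrX expr2 mulrA mulrC ler_wpM2l//.
rewrite (@le_trans _ _ ((`|K| + 1) * `|h|))//.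
  by rewrite ler_wpM2r// (le_trans (ler_norm K))// lerDl.
rewrite -ler_pdivlMl//; near: h; apply: dnbhs0_le.
by rewrite mulr_gt0// invr_gt0.
Unshelve. all: end_near. Qed.

Lemma lipschitz_continuous F K : (forall x y, `|F y - F x| <= K * `|y - x|) ->
  continuous F.
Proof.
move=> FK x; apply/cvgrPdist_le => e e0.
have K1 : 0 < `|K| + 1 by rewrite ltr_wpDl.
near=> y; rewrite (le_trans (FK _ _))//.
rewrite (@le_trans _ _ ((`|K| + 1) * `|x - y|))//.
  by rewrite ler_wpM2r// (le_trans (ler_norm K))// lerDl.
rewrite -ler_pdivlMl//; near: y; apply: cvgr_dist_le; first exact: cvg_id.
by rewrite mulr_gt0// invr_gt0.
Unshelve. all: end_near. Qed.

Definition sgsqr (z : R) : R := z * `|z|.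

Lemma sgsqr_taylor x y : `|sgsqr y - sgsqr x - 2 * `|x| * (y - x)| <= (y - x) ^+ 2.
Proof.
rewrite /sgsqr ler_norml.
have s1 := sqr_ge0 (y - x); have s2 := sqr_ge0 x; have s3 := sqr_ge0 y.
have [x0|x0] := ger0P x; have [y0|y0] := ger0P y.
- by have := mulr_ge0 x0 y0 => xy; apply/andP; split; nra.
- by have := mulr_ge0_le0 x0 (ltW y0) => xy; apply/andP; split; nra.
- by have := mulr_le0_ge0 (ltW x0) y0 => xy; apply/andP; split; nra.
- by have := mulr_le0 (ltW x0) (ltW y0) => xy; apply/andP; split; nra.
Qed.

(** The ramp rises from [0] to [1] between [a - d] and [a + d]; its derivative is
    the tent of height [1 / d] over this interval. A formula without case
    distinction makes the derivative computable in one stroke from that of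
    [sgsqr]. *)
Definition ramp a d y : R := 2^-1 +
  (sgsqr (y - a + d) - 2 * sgsqr (y - a) + sgsqr (y - a - d)) / (4 * d ^+ 2).

Definition tent a d y : R :=
  (`|y - a + d| - 2 * `|y - a| + `|y - a - d|) / (2 * d ^+ 2).

Lemma ramp_taylor a d x y : 0 < d ->
  `|ramp a d y - ramp a d x - tent a d x * (y - x)| <= (d ^+ 2)^-1 * (y - x) ^+ 2.
Proof.
move=> d0.
have T1 := sgsqr_taylor (x - a + d) (y - a + d).
have T2 := sgsqr_taylor (x - a) (y - a).
have T3 := sgsqr_taylor (x - a - d) (y - a - d).
have E1 : y - a + d - (x - a + d) = y - x by ring.
have E2 : y - a - (x - a) = y - x by ring.
have E3 : y - a - d - (x - a - d) = y - x by ring.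
move: T1 T2 T3; rewrite E1 E2 E3 => T1 T2 T3.
have dn : d != 0 by rewrite gt_eqF.
rewrite [leRHS]mulrC ler_pdivlMr ?exprn_gt0// -(ger0_norm (sqr_ge0 d)) -normrM.
rewrite /ramp /tent.
set u1 := sgsqr (y - a + d) in T1 *; set u2 := sgsqr (y - a) in T2 *.
set u3 := sgsqr (y - a - d) in T3 *.
set v1 := sgsqr (x - a + d) in T1 *; set v2 := sgsqr (x - a) in T2 *.
set v3 := sgsqr (x - a - d) in T3 *.
set w1 := `|x - a + d| in T1 *; set w2 := `|x - a| in T2 *.
set w3 := `|x - a - d| in T3 *.
rewrite [X in `|X|](_ : _ = ((u1 - v1 - 2 * w1 * (y - x))
  - 2 * (u2 - v2 - 2 * w2 * (y - x)) + (u3 - v3 - 2 * w3 * (y - x))) / 4);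
  last by field.
move: T1 T2 T3; rewrite !ler_norml => /andP[? ?] /andP[? ?] /andP[? ?].
by apply/andP; split; lra.
Qed.

Lemma tent_lipschitz a d x y : 0 < d ->
  `|tent a d y - tent a d x| <= 2 / d ^+ 2 * `|y - x|.
Proof.
move=> d0; have dn : d != 0 by rewrite gt_eqF.
have T1 := ler_dist_dist (y - a + d) (x - a + d).
have T2 := ler_dist_dist (y - a) (x - a).
have T3 := ler_dist_dist (y - a - d) (x - a - d).
have E1 : y - a + d - (x - a + d) = y - x by ring.
have E2 : y - a - (x - a) = y - x by ring.
have E3 : y - a - d - (x - a - d) = y - x by ring.
move: T1 T2 T3; rewrite E1 E2 E3 => T1 T2 T3.
rewrite mulrAC ler_pdivlMr ?exprn_gt0// -{1}(ger0_norm (sqr_ge0 d)) -normrM.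
rewrite /tent.
set u1 := `|y - a + d| in T1 *; set u2 := `|y - a| in T2 *.
set u3 := `|y - a - d| in T3 *.
set v1 := `|x - a + d| in T1 *; set v2 := `|x - a| in T2 *.
set v3 := `|x - a - d| in T3 *.
rewrite [X in `|X| <= _](_ : _ = ((u1 - v1) - 2 * (u2 - v2) + (u3 - v3)) / 2);
  last by field.
move: T1 T2 T3; rewrite !ler_norml => /andP[? ?] /andP[? ?] /andP[? ?].
by apply/andP; split; lra.
Qed.

Lemma tent_continuous a d : 0 < d -> continuous (tent a d).
Proof.
by move=> d0; apply: (@lipschitz_continuous _ (2 / d ^+ 2)) => x y; exact: tent_lipschitz.
Qed.

Lemma is_derive_ramp a d x : 0 < d -> is_derive x 1 (ramp a d) (tent a d x).
Proof.
move=> d0; apply: (@is_derive_quadratic _ (d ^+ 2)^-1) => y.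
exact: ramp_taylor.
Qed.

Lemma tent_out a d y : 0 < d -> d <= `|y - a| -> tent a d y = 0.
Proof.
move=> d0; rewrite /tent; have [ya|ya] := ger0P (y - a) => dy.
  by rewrite !ger0_norm; [rewrite [X in X / _](_ : _ = 0) ?mul0r//; ring|lra..].
by rewrite !ler0_norm; [rewrite [X in X / _](_ : _ = 0) ?mul0r//; ring|lra..].
Qed.

Lemma tent_ge0 a d y : 0 < d -> 0 <= tent a d y.
Proof.
move=> d0; rewrite /tent divr_ge0//; last by rewrite mulr_ge0// sqr_ge0.
have := ler_normD (y - a + d) (y - a - d).
have -> : y - a + d + (y - a - d) = 2 * (y - a) by ring.
by rewrite normrM (ger0_norm (ler0n _ 2)); lra.
Qed.

Lemma tent_le a d y : 0 < d -> tent a d y <= d^-1.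
Proof.
move=> d0; have dn : d != 0 by rewrite gt_eqF.
rewrite /tent ler_pdivrMr ?mulr_gt0 ?exprn_gt0//.
rewrite (_ : d^-1 * _ = 2 * d); last by field.
have := ler_normD (y - a) d; have := ler_normB (y - a) d.
by rewrite (gtr0_norm d0); lra.
Qed.

Lemma ramp_left a d y : 0 < d -> y <= a - d -> ramp a d y = 0.
Proof.
move=> d0 ya; have dn : d != 0 by rewrite gt_eqF.
by rewrite /ramp /sgsqr !ler0_norm; [field|lra..].
Qed.

Lemma ramp_right a d y : 0 < d -> a + d <= y -> ramp a d y = 1.
Proof.
move=> d0 ya; have dn : d != 0 by rewrite gt_eqF.
by rewrite /ramp /sgsqr !ger0_norm; [field|lra..].
Qed.

Lemma ac_ramp a d : 0 < d -> ac (ramp a d) (tent a d).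
Proof.
move=> d0.
have := @ac_comp R (ramp a d) (tent a d) (2 / d ^+ 2) id (cst 1) _ ac_id.
move=> H; apply: ac_eq (H _ _ _ _) => //.
- by move=> x; rewrite mulr1.
- by rewrite divr_ge0// sqr_ge0.
- apply: measurable_funTS; apply: continuous_measurable_fun.
  exact: tent_continuous.
- move=> x y _ _; rewrite (le_trans (ramp_taylor _ _ _ _))// ler_wpM2r ?sqr_ge0//.
  by rewrite ler_peMl ?invr_ge0 ?sqr_ge0// ler1n.
- by move=> x y _ _; exact: tent_lipschitz.
Qed.

Lemma C1c_ramps a b d : 0 < d -> 0 < a - d -> a <= b -> b + d < 1 ->
  C1c (fun y => ramp a d y - ramp b d y).
Proof.
move=> d0 ad ab bd.
have D x : is_derive x 1 (fun y => ramp a d y - ramp b d y) (tent a d x - tent b d x).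
  by apply: is_deriveB; exact: is_derive_ramp.
split.
- by move=> x; exact: ex_derive.
- rewrite (_ : derive1 _ = (fun x => tent a d x - tent b d x)); last first.
    by apply/funext => x; rewrite derive1E derive_val.
  by move=> x; apply: cvgB; exact: tent_continuous.
- exists (a - d), (b + d); split; [by []|lra|move=> x].
  rewrite in_itv/= negb_and -!ltNge => /orP[xa|bx].
    by rewrite !ramp_left//; lra.
  by rewrite !ramp_right//; lra.
Qed.

Lemma derive1_ramps a b d y : 0 < d ->
  derive1 (fun y => ramp a d y - ramp b d y) y = tent a d y - tent b d y.
Proof.
move=> d0; rewrite derive1E; have := is_derive_ramp a y d0.
move=> Da; have Db := is_derive_ramp b y d0.
have D : is_derive y 1 (fun y => ramp a d y - ramp b d y) (tent a d y - tent b d y).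
  by apply: is_deriveB.
by rewrite derive_val.
Qed.

Lemma L1_tent a d g : 0 < d -> L1 g -> L1 (fun x => tent a d x * g x).
Proof.
move=> d0; apply: (@L1M _ _ _ d^-1).
  apply: measurable_funTS; apply: continuous_measurable_fun.
  exact: tent_continuous.
by move=> x _; rewrite ger0_norm ?tent_ge0// tent_le.
Qed.

Lemma itg_tent a d : 0 < d -> 0 <= a - d -> a + d <= 1 -> itg 0 1 (tent a d) = 1.
Proof.
move=> d0 ad da; rewrite -(ac_incr (ac_ramp a d0))//.
by rewrite ramp_right// ramp_left// subr0.
Qed.

(** The tent has mass [1] and is at most [1 / d], so that the error is controlled
    by the mean oscillation of [G] over a ball around [a]. *)
Lemma tent_lebesgue_pt G a (e : R) : L1 G -> 0 < a < 1 ->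
  lebesgue_pt (G \_ I01) a -> 0 < e ->
  \forall d \near 0^'+, `|itg 0 1 (fun x => tent a d x * G x) - G a| <= e.
Proof.
move=> IG /andP[a0 a1] La e0.
have e4 : 0 < e / 4 by rewrite divr_gt0.
have {}La : \forall d \near 0^'+, (davg (G \_ I01) a d < (e / 4)%:E)%E.
  by apply: (La [set u | (u < (e / 4)%:E)%E]); apply: open_ereal_lt'; rewrite lte_fin.
move: La => /nbhs_ballP[r /= r0 rP].
near=> d.
have d0 : 0 < d by near: d; exact: nbhs_right_gt.
have dn : d != 0 by rewrite gt_eqF.
have da : d <= a by near: d; exact: nbhs_right_ltW.
have d1a : d <= 1 - a by near: d; apply: nbhs_right_ltW; rewrite subr_gt0.
have dr : d < r / 2 by near: d; apply: nbhs_right_lt; rewrite divr_gt0.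
have Lad : (davg (G \_ I01) a (2 * d) < (e / 4)%:E)%E.
  apply: rP; last by rewrite mulr_gt0.
  by rewrite /ball/= sub0r normrN gtr0_norm ?mulr_gt0//; lra.
have ad0 : 0 <= a - d by rewrite subr_ge0.
have ad1 : a + d <= 1 by lra.
have aI : I01 a by rewrite /= in_itv/= !ltW.
pose D x : R := `|G x - G a|.
have IGa : L1 (fun x => G x - G a) by apply: L1B => //; exact: L1_cst.
have ID : L1 D by exact: L1_norm.
have It : L1 (tent a d) by have [] := ac_ramp a d0.
have -> : itg 0 1 (fun x => tent a d x * G x) - G a =
    itg 0 1 (fun x => tent a d x * (G x - G a)).
  rewrite [X in _ - X = _](_ : G a = itg 0 1 (fun x => G a * tent a d x)).
    rewrite -itgB//.
    - by apply: eq_itg => x _; ring.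
    - exact: L1_tent.
    - exact: L1Z.
  by rewrite itgZ// itg_tent// mulr1.
have Z u v : 0 <= u -> v <= 1 -> u <= v ->
    (forall x, u <= x <= v -> d <= `|x - a|) ->
    itg u v (fun x => tent a d x * (G x - G a)) = 0.
  move=> u0 v1 uv duv; rewrite (@eq_itg _ _ _ _ (fun=> 0)); last first.
    by move=> x xuv; rewrite tent_out ?mul0r//; exact: duv.
  by rewrite itg_cst// mul0r.
have ItG : L1 (fun x => tent a d x * (G x - G a)) by exact: L1_tent.
rewrite (@itg_split _ (a - d) 0 1)// ?(Z 0 (a - d))//; try lra; last first.
  by move=> x /andP[x0 xd]; rewrite ler0_norm; lra.
rewrite add0r (@itg_split _ (a + d) (a - d) 1)// ?(Z (a + d) 1)//; try lra; last first.
  by move=> x /andP[x0 xd]; rewrite ger0_norm; lra.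
rewrite addr0.
have Dle : `|itg (a - d) (a + d) (fun x => tent a d x * (G x - G a))|
    <= d^-1 * itg (a - d) (a + d) D.
  rewrite -itgZ//; apply: norm_itg_le => //; first exact: L1Z.
  move=> x _; rewrite normrM ler_wpM2r//.
  by rewrite ger0_norm ?tent_ge0// tent_le.
rewrite (le_trans Dle)// mulrC ler_pdivrMr// -lee_fin.
pose S : set R := `[a - d, a + d]%classic.
have Iad : mu.-integrable S (EFin \o D) by exact: L1S.
have -> : (itg (a - d) (a + d) D)%:E = (\int[mu]_(x in S) (D x)%:E)%E.
  by rewrite /itg /Rintegral fineK//; exact: integrable_fin_num.
have sub : S `<=` ball a (2 * d).
  by move=> x /=; rewrite /S/= in_itv/= /ball/= ltr_norml => /andP[? ?]; lra.
have -> : (\int[mu]_(x in S) (D x)%:E =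
    \int[mu]_(x in S) `|((G \_ I01) x - (G \_ I01) a)%:E|)%E.
  apply: eq_integral => x; rewrite inE/= /S/= in_itv/= => /andP[? ?].
  have xI : I01 x by rewrite /= in_itv/=; lra.
  by rewrite !patchE !mem_set.
apply: (@le_trans _ _ (\int[mu]_(x in ball a (2 * d))
     `|((G \_ I01) x - (G \_ I01) a)%:E|)%E).
  apply: ge0_subset_integral => //.
  - exact: measurable_itv.
  - exact: measurable_ball.
  - apply/measurable_EFinP; apply: measurableT_comp => //.
    apply: measurable_funB => //; apply: measurable_funTS.
    by apply/(measurable_restrictT _ _).1 => //; exact: L1_measurable.
have := ltW Lad; rewrite /davg /iavg lebesgue_measure_ball; last by rewrite mulr_ge0// ltW.
rewrite inver mulrn_eq0/= mulf_eq0 (negPf dn) orbF pnatr_eq0/=.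
rewrite lee_pdivrMl; last by rewrite mulrn_wgt0// mulr_gt0.
move=> /le_trans; apply; rewrite -EFinM lee_fin le_eqVlt; apply/orP; left.
by apply/eqP; rewrite -mulr_natr; field.
Unshelve. all: end_near. Qed.

Lemma ae_exists (P : R -> Prop) a b : a < b -> {ae mu, forall x, P x} ->
  exists2 x, a < x < b & P x.
Proof.
move=> ab aeP; apply: contrapT => nP.
have : mu.-negligible (`]a, b[%classic : set R).
  apply: negligibleS aeP => x /=; rewrite in_itv/= => xab Px.
  by apply: nP; exists x.
move=> /negligibleP -/(_ (measurable_itv _)).
by rewrite /= lebesgue_measure_itv/= lte_fin ab -EFinD => /eqP; rewrite eqe subr_eq0 gt_eqF.
Qed.

Lemma ae_eq_continuous F G : {within I01, continuous F} ->
  {within I01, continuous G} ->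
  {ae mu, forall y, I01 y -> F y = G y} ->
  forall y, 0 <= y <= 1 -> F y = G y.
Proof.
move=> cF cG FG y yI; apply/eqP; rewrite -subr_eq0 -normr_eq0; apply/negP => /negP n0.
have {}n0 : 0 < `|F y - G y| by rewrite lt_def n0 normr_ge0.
have /subspace_continuousP/(_ y) := within_continuousB cF cG.
rewrite /= in_itv/= => /(_ yI) /cvgrPdist_lt/(_ _ n0).
rewrite near_withinE => /nbhs_ballP[r /= r0 rP].
have [y0 y1] := andP yI.
have [|x /andP[x1 x2] E] := @ae_exists _ (Num.max 0 (y - r)) (Num.min 1 (y + r)) _ FG.
  by rewrite gt_max !lt_min !ltr01/=; lra.
have {x1 x2} [x0 xr xy x1] : [/\ 0 < x, y - r < x, x < y + r & x < 1].
  by move: x1 x2; rewrite gt_max lt_min => /andP[? ?] /andP[? ?]; split.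
have xI : I01 x by rewrite /= in_itv/= !ltW.
have : `|(F y - G y) - (F x - G x)| < `|F y - G y|.
  by apply: rP xI; rewrite /ball/= ltr_distlC xr.
by rewrite (E xI) subrr subr0 ltxx.
Qed.

Lemma ae_neq c : {ae mu, forall x : R, x <> c}.
Proof.
exists [set c]; split; [exact: measurable_set1|exact: lebesgue_measure_set1|].
by move=> x /= /contrapT.
Qed.

(** du Bois-Reymond: [F] minus the primitive of [f] has the same integral
    against all tent functions, hence the same value at all Lebesgue points. *)
Lemma weak_deriv_ac F f : weak_deriv F f -> exists G, ac G f /\
  {ae mu, forall y, I01 y -> F y = G y}.
Proof.
move=> [IF If wd].
pose H y := itg 0 y f.
have aH : ac H f by split=> // y _; rewrite /H itgaa add0r.
pose G x := F x - H x.
have IG : L1 G by apply: L1B => //; exact: ac_L1 aH.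
have key a b d : 0 < d -> 0 < a - d -> a <= b -> b + d < 1 ->
    itg 0 1 (fun x => tent a d x * G x) = itg 0 1 (fun x => tent b d x * G x).
  move=> d0 ad ab bd.
  pose p x := ramp a d x - ramp b d x; pose p' x := tent a d x - tent b d x.
  have ap : ac p p' by apply: acB; exact: ac_ramp.
  have := wd _ (C1c_ramps d0 ad ab bd); rewrite -/p.
  under eq_Rintegral do rewrite derive1_ramps//.
  rewrite -/(itg 0 1 (fun y => F y * p' y)) -/(itg 0 1 (fun y => f y * p y)) => E.
  have IFp : L1 (fun y => F y * p' y).
    have := L1B (L1_tent a d0 IF) (L1_tent b d0 IF).
    by congr L1; apply/funext => x; rewrite /p'; ring.
  have aM := acM aH ap.
  have := ac_incr aM (lexx 0) ler01 (lexx 1).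
  have [ad1 b0] : a + d <= 1 /\ 0 <= b - d by split; lra.
  rewrite /p !(ramp_right d0 ad1) !(ramp_right d0 (ltW bd)).
  rewrite (ramp_left d0 (ltW ad)) (ramp_left d0 b0).
  rewrite !subrr !mulr0 subrr itgD//; last 2 first.
    exact: acL1M ap If.
    by apply: (acML1 aH); case: ap.
  move=> E2; apply/eqP; rewrite -subr_eq0 -itgB//; try exact: L1_tent.
  rewrite (@eq_itg _ _ _ _ (fun x => F x * p' x - H x * p' x)); last first.
    by move=> x _; rewrite /G /p'; ring.
  rewrite itgB//; last by apply: (acML1 aH); case: ap.
  by rewrite E; apply/eqP; lra.
have ae1 : {ae mu, forall x, lebesgue_pt (G \_ I01) x}.
  by apply: lebesgue_differentiation; exact: integrable_locally.
have G_eq a b : 0 < a -> a <= b -> b < 1 -> lebesgue_pt (G \_ I01) a ->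
    lebesgue_pt (G \_ I01) b -> G a = G b.
  move=> a0 ab b1 La Lb; apply/eqP; rewrite -subr_eq0 -normr_le0.
  apply/ler_addgt0Pr => e e0; rewrite add0r.
  have e2 : 0 < e / 2 by rewrite divr_gt0.
  have aI : 0 < a < 1 by rewrite a0 (le_lt_trans ab).
  have bI : 0 < b < 1 by rewrite b1 (lt_le_trans a0).
  have Na := tent_lebesgue_pt IG aI La e2; have Nb := tent_lebesgue_pt IG bI Lb e2.
  near (0:R)^'+ => d.
  have d0 : 0 < d by near: d; exact: nbhs_right_gt.
  have da : d < a by near: d; exact: nbhs_right_lt.
  have db : d < 1 - b by near: d; apply: nbhs_right_lt; rewrite subr_gt0.
  have Ha : `|itg 0 1 (fun x => tent a d x * G x) - G a| <= e / 2.
    by near: d.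
  have Hb : `|itg 0 1 (fun x => tent b d x * G x) - G b| <= e / 2.
    by near: d.
  move: Ha; rewrite (key a b d)//; try lra.
  move: Hb; rewrite !ler_norml => /andP[? ?] /andP[? ?]; apply/andP; split; lra.
have [a0 /andP[a00 a01] La] := ae_exists ltr01 ae1.
exists (fun x => G a0 + H x); split.
  by apply: ac_eq (acD (ac_cst (G a0)) aH) => // x; rewrite add0r.
apply: (@filterS3 _ _ (ae_filter_ringOfSetsType mu) _ _ _ _ _ (ae_neq 0) (ae_neq 1) ae1).
move=> x x0 x1 Lx; rewrite /= in_itv/= => /andP[]; rewrite !le_eqVlt.
move=> /predU1P[/esym//|x0'] /predU1P[//|x1'].
suff -> : G a0 = G x by rewrite /G subrK.
by have [ax|/ltW ax] := leP a0 x; [|apply/esym]; exact: G_eq.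
Unshelve. all: end_near. Qed.
End WeakDerivative.

(** * Chain rules and oscillatory integrals *)

Section ChainRule.
Context {R : realType}.
Implicit Types (f g F G h : R -> R) (a b c x y l M : R).
Local Notation mu := (@lebesgue_measure R).
Local Notation I01 := `[0%R : R, 1%R : R]%classic.

Lemma derive_taylor h (h' : R -> R) c K :
  (forall x, is_derive x 1 h (h' x)) ->
  (forall x y, `|x| <= c -> `|y| <= c -> `|h' y - h' x| <= K * `|y - x|) ->
  forall x y, `|x| <= c -> `|y| <= c ->
    `|h y - h x - h' x * (y - x)| <= K * (y - x) ^+ 2.
Proof.
move=> dh hK x y xc yc.
have ch : continuous h.
  by move=> z; apply/differentiable_continuous/derivable1_diffP/ex_derive.
have H z : `|z| <= c -> `|z - x| <= `|y - x| -> h y - h x = h' z * (y - x) ->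
    `|h y - h x - h' x * (y - x)| <= K * (y - x) ^+ 2.
  move=> zc zxy ->; rewrite -mulrBl normrM -(ger0_norm (sqr_ge0 (y - x))).
  rewrite normrX expr2 mulrA ler_wpM2r// (le_trans (hK _ _ xc zc))//.
  have K0 : 0 <= K * `|z - x| by rewrite (le_trans _ (hK _ _ xc zc)).
  have [->|/eqP zx] := eqVneq z x.
    rewrite subrr normr0 mulr0.
    have [->|yx] := eqVneq y x; first by rewrite subrr normr0 mulr0.
    by rewrite (le_trans _ (hK _ _ xc yc)).
  have : 0 < `|z - x| by rewrite normr_gt0 subr_eq0; exact/eqP.
  by move=> zx0; rewrite ler_wpM2l// -(pmulr_lge0 _ zx0).
have /andP[x1 x2] : - c <= x <= c by rewrite -ler_norml.
have /andP[y1 y2] : - c <= y <= c by rewrite -ler_norml.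
have [xy|/ltW xy] := leP x y.
  have [|z zI E] := @MVT_segment _ h h' x y xy _ _.
    exact: continuous_subspaceT.
  move: zI; rewrite in_itv/= => /andP[xz zy]; apply: (H z _ _ E).
    by rewrite ler_norml; lra.
  by rewrite !ger0_norm; lra.
have [|z zI E] := @MVT_segment _ h h' y x xy _ _.
  exact: continuous_subspaceT.
move: zI; rewrite in_itv/= => /andP[xz zy]; apply: (H z).
- by rewrite ler_norml; lra.
- by rewrite !ler0_norm; lra.
- by rewrite -opprB E; ring.
Qed.

Lemma derive_lipschitz h (h' : R -> R) c K :
  (forall x, is_derive x 1 h (h' x)) ->
  (forall x, `|x| <= c -> `|h' x| <= K) ->
  forall x y, `|x| <= c -> `|y| <= c -> `|h y - h x| <= K * `|y - x|.
Proof.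
move=> dh hK x y.
have ch : continuous h.
  by move=> z; apply/differentiable_continuous/derivable1_diffP/ex_derive.
wlog xy : x y / x <= y => [th xc yc|].
  by have [|/ltW] := leP x y => xy; [|rewrite distrC (distrC y)]; exact: th.
rewrite !ler_norml => /andP[x1 x2] /andP[y1 y2].
have [|z zI E] := @MVT_segment _ h h' x y xy _ _.
  exact: continuous_subspaceT.
move: zI; rewrite in_itv/= => /andP[xz zy].
rewrite -ler_norml E normrM ler_wpM2r// hK// ler_norml; lra.
Qed.

(** A bound on the second derivative over bounded sets gives the quadratic Taylor
    remainder that the chain rule asks for. *)
Lemma ac_comp_derive h (h' h'' : R -> R) F f : ac F f ->
  (forall x, is_derive x 1 h (h' x)) -> (forall x, is_derive x 1 h' (h'' x)) ->
  (forall c, exists2 K, 0 <= K & forall x, `|x| <= c -> `|h'' x| <= K) ->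
  ac (fun x => h (F x)) (fun x => h' (F x) * f x).
Proof.
move=> aF dh dh' hK; have [c _ Fc] := ac_bounded aF; have [K K0 h''K] := hK c.
have hL := derive_lipschitz dh' h''K.
apply: (ac_comp K0 aF).
- apply: measurableT_comp; last exact: ac_measurable aF.
  apply: continuous_measurable_fun.
  by move=> z; apply/differentiable_continuous/derivable1_diffP/ex_derive.
- by move=> x y xI yI; apply: (derive_taylor dh hL); exact: Fc.
- by move=> x y xI yI; apply: hL; exact: Fc.
Qed.

Lemma ac_expR F f : ac F f ->
  ac (fun x => expR (F x)) (fun x => expR (F x) * f x).
Proof.
move=> aF; apply: (ac_comp_derive (h'' := expR)) => // c.
exists (expR c); first exact: expR_ge0.
move=> x; rewrite ler_norml => /andP[_ xc].
by rewrite ger0_norm ?expR_ge0// ler_expR.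
Qed.

Lemma ac_sin l : ac (fun x => sin (l * x)) (fun x => l * cos (l * x)).
Proof.
have := ac_comp_derive (acZ l (@ac_id R)) (@is_derive_sin R) (@is_derive_cos R) _.
move=> H; apply: ac_eq (H _) => [//|x|c]; first by rewrite mulr1 mulrC.
by exists 1 => // x _; rewrite normrN ler_norml sin_geN1 sin_le1.
Qed.

Lemma ac_cos l : ac (fun x => cos (l * x)) (fun x => - (l * sin (l * x))).
Proof.
have dNs x : is_derive x 1 (fun x : R => - sin x) (- cos x) by apply: is_deriveN.
have := ac_comp_derive (acZ l (@ac_id R)) (@is_derive_cos R) dNs _.
move=> H; apply: ac_eq (H _) => [//|x|c]; first by rewrite mulr1 mulNr mulrC.
by exists 1 => // x _; rewrite normrN ler_norml cos_geN1 cos_le1.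
Qed.

Lemma ac_inv F f m : 0 < m -> (forall y, 0 <= y <= 1 -> m <= F y) -> ac F f ->
  ac (fun x => (F x)^-1) (fun x => - (F x)^-1 ^+ 2 * f x).
Proof.
move=> m0 mF aF.
have F0 x : 0 <= x <= 1 -> 0 < F x by move=> xI; exact: lt_le_trans (mF _ xI).
have iF x : 0 <= x <= 1 -> 0 < (F x)^-1 <= m^-1.
  by move=> xI; rewrite invr_gt0 F0// lef_pV2 ?posrE ?F0// mF.
have cF : {within I01, continuous (fun x => (F x)^-1)}.
  apply/subspace_continuousP => x xI; apply: cvgV.
    by rewrite gt_eqF// F0//; move: xI; rewrite /= in_itv.
  by have /subspace_continuousP := ac_cont aF; exact.
have mi : 0 < m^-1 by rewrite invr_gt0.
have E x y : 0 <= x <= 1 -> 0 <= y <= 1 ->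
    (F y)^-1 - (F x)^-1 = - ((F y)^-1 * (F x)^-1 * (F y - F x)).
  by move=> xI yI; have x0 := F0 _ xI; have y0 := F0 _ yI; field; rewrite !gt_eqF.
apply: (@ac_comp _ GRing.inv (fun u => - u^-1 ^+ 2) (2 * m^-1 ^+ 3)) => //.
- by rewrite mulr_ge0// exprn_ge0// ltW.
- rewrite (_ : _ \o F = (fun x => - ((F x)^-1 * (F x)^-1))); last first.
    by apply/funext => x /=; rewrite expr2.
  have mF' : measurable_fun I01 (fun x => (F x)^-1).
    exact: subspace_continuous_measurable_fun.
  by apply: measurableT_comp => //; exact: measurable_funM.
- move=> x y xI yI.
  have x0 := F0 _ xI; have y0 := F0 _ yI.
  rewrite (_ : _ - _ = (F x)^-1 ^+ 2 * (F y)^-1 * (F y - F x) ^+ 2); last first.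
    by field; rewrite !gt_eqF.
  rewrite normrM (ger0_norm (sqr_ge0 (F y - F x))) ler_wpM2r ?sqr_ge0//.
  have /andP[ix0 ixm] := iF x xI; have /andP[iy0 iym] := iF y yI.
  rewrite normrM normrX !gtr0_norm// (@le_trans _ _ (m^-1 ^+ 3))//.
    have sq : (F x)^-1 ^+ 2 <= m^-1 ^+ 2 by rewrite !expr2 ler_pM// ltW.
    by rewrite (exprSr m^-1 2) ler_pM ?sqr_ge0// ltW.
  by rewrite ler_peMl ?ler1n// exprn_ge0// ltW.
- move=> x y xI yI.
  have /andP[ix0 ixm] := iF x xI; have /andP[iy0 iym] := iF y yI.
  rewrite (_ : _ - _ = - (((F y)^-1 - (F x)^-1) * ((F y)^-1 + (F x)^-1))); last by ring.
  rewrite E// mulNr opprK mulrAC normrM ler_wpM2r// ger0_norm; last first.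
    by rewrite ltW// !mulr_gt0// addr_gt0.
  rewrite (_ : 2 * _ = m^-1 * m^-1 * (m^-1 + m^-1)); last by ring.
  by rewrite !ler_pM ?mulr_ge0 ?addr_ge0 ?lerD// ltW.
Qed.

Lemma norm_sin l : `|sin l| <= 1 :> R.
Proof. by rewrite ler_norml sin_geN1 sin_le1. Qed.

Lemma norm_cos l : `|cos l| <= 1 :> R.
Proof. by rewrite ler_norml cos_geN1 cos_le1. Qed.

Lemma norm_itgM (u : R -> R) F f M : ac F f ->
  (forall y, 0 <= y <= 1 -> `|F y| <= 1) ->
  L1 u -> itg 0 1 (fun y => `|u y|) <= M ->
  `|itg 0 1 (fun y => u y * F y)| <= M.
Proof.
move=> aF F1 Iu uM; rewrite (le_trans _ uM)//.
apply: norm_itg_le => //; [exact: acL1M aF Iu|exact: L1_norm|].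
by move=> y yI; rewrite normrM ler_piMr// F1.
Qed.

(** Two integrations by parts. Only the value of the amplitude at the boundary
    point [0] contributes at order [1 / l]. *)
Lemma oscillatory_integrals A A1 A2 M l : ac A A1 -> ac A1 A2 -> A 1 = 0 ->
  (forall y, 0 <= y <= 1 -> `|A1 y| <= M) -> itg 0 1 (fun y => `|A2 y|) <= M ->
  `|l ^+ 2 * itg 0 1 (fun y => A y * cos (l * y))| <= 3 * M /\
  `|l ^+ 2 * itg 0 1 (fun y => A y * sin (l * y)) - l * A 0| <= 3 * M.
Proof.
move=> aA aA1 A10 A1M A2M.
have as_ := ac_sin l; have ac_ := ac_cos l.
have [IA1 _] := aA; have [IA2 _] := aA1; have IA := ac_L1 aA.
have sinL := norm_itgM as_ (fun _ _ => norm_sin _) IA2 A2M.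
have cosL := norm_itgM ac_ (fun _ _ => norm_cos _) IA2 A2M.
have P F f G g : ac F f -> ac G g -> L1 F ->
    itg 0 1 (fun y => f y * G y) + itg 0 1 (fun y => F y * g y) = F 1 * G 1 - F 0 * G 0.
  move=> aF aG IF; rewrite (ac_incr (acM aF aG))// itgD//.
    by apply: acL1M aG _; case: aF.
  by apply: acML1 aF _; case: aG.
have Z (F G : R -> R) (c : R) : L1 (fun y => F y * G y) ->
    itg 0 1 (fun y => F y * (c * G y)) = c * itg 0 1 (fun y => F y * G y).
  by move=> IFG; rewrite -itgZ//; apply: eq_itg => y _; ring.
have ZN (F G : R -> R) (c : R) : L1 (fun y => F y * G y) ->
    itg 0 1 (fun y => F y * - (c * G y)) = - (c * itg 0 1 (fun y => F y * G y)).
  by move=> IFG; rewrite -mulNr -Z//; apply: eq_itg => y _; ring.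
have E1 := P _ _ _ _ aA as_ IA; have E2 := P _ _ _ _ aA1 ac_ IA1.
have E3 := P _ _ _ _ aA ac_ IA; have E4 := P _ _ _ _ aA1 as_ IA1.
move: E1 E2 E3 E4.
rewrite !Z ?ZN; try exact: acL1M as_ _; try exact: acL1M ac_ _.
rewrite !A10 !mulr0 !sin0 !cos0 !mulr1 !mul0r !mulr0.
set cA := itg 0 1 (fun y => A y * cos _); set sA := itg 0 1 (fun y => A y * sin _).
set cA1 := itg 0 1 (fun y => A1 y * cos _); set sA1 := itg 0 1 (fun y => A1 y * sin _).
set cA2 := itg 0 1 (fun y => A2 y * cos _) in cosL *.
set sA2 := itg 0 1 (fun y => A2 y * sin _) in sinL *.
move=> E1 E2 E3 E4.
have H0 := A1M 0; have H1 := A1M 1; rewrite !lexx !ler01 in H0 H1.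
have C1 : `|A1 1 * cos l| <= M.
  by rewrite normrM (le_trans _ (H1 isT))// ler_piMr// norm_cos.
have S1 : `|A1 1 * sin l| <= M.
  by rewrite normrM (le_trans _ (H1 isT))// ler_piMr// norm_sin.
split.
  rewrite (_ : _ * cA = A1 1 * cos l - A1 0 - cA2).
    rewrite (le_trans (ler_normB _ _))//.
    by have := ler_normB (A1 1 * cos l) (A1 0); have := H0 isT; lra.
  have -> : l ^+ 2 * cA = l * (l * cA) by ring.
  have -> : l * cA = - sA1 by lra.
  by lra.
rewrite (_ : _ - _ = A1 1 * sin l - sA2).
  by rewrite (le_trans (ler_normB _ _))//; have := normr_ge0 (A1 0); have := H0 isT; lra.
have -> : l ^+ 2 * sA = l * (l * sA) by ring.
have -> : l * sA = cA1 + A 0 by lra.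
by lra.
Qed.

End ChainRule.

(** * The elliptic system in the moving frame *)

Section StreamFunction.
Context {R : realType}.
Implicit Types (f g F G W V X P : R -> R) (a b c x y l B K M : R).
Local Notation mu := (@lebesgue_measure R).
Local Notation I01 := `[0%R : R, 1%R : R]%classic.

(** With [r = k / g] and [X = g P' / k], this is the Dirichlet problem for
    [- P + (g d/dy / k) ^ 2 P = V]. *)
Definition stream_system (r V X P : R -> R) : Prop :=
  [/\ ac P (fun y => r y * X y), ac X (fun y => r y * (P y + V y)),
      P 0 = 0 & P 1 = 0].

(** A uniform bound in C^1 and a bound on the second derivative in L^1: the
    consequences of a bound in H^2 that the asymptotics relies on. *)
Definition H2_bounded W B : Prop := exists W1 w2 : R -> R,
  [/\ ac W W1, ac W1 w2, forall y, 0 <= y <= 1 -> `|W y| <= B,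
      forall y, 0 <= y <= 1 -> `|W1 y| <= B & itg 0 1 (fun y => `|w2 y|) <= B].

Variables (r r1 r2 : R -> R).
Hypotheses (ar : ac r r1) (ar1 : ac r1 r2) (S0 : itg 0 1 r != 0).

Local Notation s y := (itg 0 y r).
Local Notation E := (expR (2 * s 1)).

(** The homogeneous solutions are the combinations of [expR (s y)] and
    [expR (- s y)]. The second factor is the one that vanishes at [1], a constant
    multiple of the hyperbolic sine of [s 1 - s y]. *)
Definition amplitude y : R := r y * (expR (s y) - E * expR (- s y)).

Lemma ac_primitive : ac (fun y => s y) r.
Proof. by have [Ir _] := ar; split; [exact: ac_L1 ar|move=> y _; rewrite itgaa add0r]. Qed.

Let ep y := expR (s y).
Let em y := expR (- s y).

Let ac_ep : ac ep (fun y => ep y * r y).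
Proof. exact: ac_expR ac_primitive. Qed.

Let ac_em : ac em (fun y => - (em y * r y)).
Proof.
have aN : ac (fun y => - s y) (fun y => - r y).
  by apply: ac_eq (acZ (-1) ac_primitive) => [x _|x]; rewrite mulN1r.
by apply: ac_eq (ac_expR aN) => [//|y]; rewrite mulrN.
Qed.

Let epem y : ep y * em y = 1.
Proof. by rewrite /ep /em -expRD subrr expR0. Qed.

Let Eem1 : E * em 1 = ep 1.
Proof. by rewrite /ep /em -expRD; congr expR; ring. Qed.

Let ep0 : ep 0 = 1. Proof. by rewrite /ep itgaa expR0. Qed.
Let em0 : em 0 = 1. Proof. by rewrite /em itgaa oppr0 expR0. Qed.

Lemma E1_neq0 : E - 1 != 0.
Proof.
rewrite subr_eq0 -[X in _ == X]expR0; apply/negP => /eqP /expR_inj H.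
by move: S0; rewrite (_ : s 1 = 0) ?eqxx//; lra.
Qed.

Lemma amplitude1 : amplitude 1 = 0.
Proof. by rewrite /amplitude -/(em 1) Eem1 /ep subrr mulr0. Qed.

Lemma amplitude0 : amplitude 0 = r 0 * (1 - E).
Proof. by rewrite /amplitude -/(em 0) -/(ep 0) ep0 em0 mulr1. Qed.

Lemma amplitude_ac : exists a1 a2 : R -> R, ac amplitude a1 /\ ac a1 a2.
Proof.
have a1 := acM ar (acB ac_ep (acZ E ac_em)).
have a2 := acM ar1 (acB ac_ep (acZ E ac_em)).
have a3 := acM (acM ar ar) (acD ac_ep (acZ E ac_em)).
have a4 := acD a2 a3.
eexists; eexists; split; first exact: a1.
by apply: ac_eq a4 => [y _|y]; last reflexivity; ring.
Qed.

Section System.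
Variables (V X P : R -> R).
Hypothesis sys : stream_system r V X P.

Lemma stream_L1 : L1 (fun y => r y * V y).
Proof.
have [aP aX _ _] := sys; have [IX _] := aX.
have := L1B IX (acML1 ar (ac_L1 aP)).
by congr L1; apply/funext => y; ring.
Qed.

(** [X - P] and [X + P] diagonalize the system; the weights [ep] and [em] turn the
    two equations into quadratures. *)
Lemma ac_outgoing : ac (fun y => ep y * (X y - P y)) (fun y => ep y * (r y * V y)).
Proof.
have [aP aX _ _] := sys.
by apply: ac_eq (acM ac_ep (acB aX aP)) => [//|y]; ring.
Qed.

Lemma ac_incoming : ac (fun y => em y * (X y + P y)) (fun y => em y * (r y * V y)).
Proof.
have [aP aX _ _] := sys.
by apply: ac_eq (acM ac_em (acD aX aP)) => [//|y]; ring.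
Qed.

(** Green's formula with the homogeneous solution that vanishes at [1]. *)
Lemma stream_boundary : (E - 1) * X 0 = itg 0 1 (fun y => amplitude y * V y).
Proof.
have [_ _ P0 P1] := sys; have IV := stream_L1.
have := ac_incr ac_outgoing (lexx 0) ler01 (lexx 1).
have := ac_incr ac_incoming (lexx 0) ler01 (lexx 1).
rewrite P0 P1 ep0 em0 !subr0 !addr0 !mul1r => I2 I1.
rewrite [RHS](@eq_itg _ _ _ _ (fun y => ep y * (r y * V y) - E * (em y * (r y * V y)))).
  rewrite itgB ?itgZ//; [|exact: acML1 ac_em _|exact: acML1 ac_ep _|].
    by rewrite -I1 -I2 -Eem1; ring.
  by apply: L1Z; exact: acML1 ac_em _.
by move=> y _; rewrite /amplitude /ep /em; ring.
Qed.

End System.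

(** The quadratures of [ac_outgoing] and [ac_incoming] bound [X] and [P] by a
    multiple of [B]; the expansion at [0] follows by integrating
    [P' = r X] and [X' = r (P + V)]. Only the size of [V] enters, not its
    derivative, which is what makes the bound uniform in time. *)
Lemma stream_bound : exists2 K, 0 <= K & forall V X P B, stream_system r V X P ->
  (forall y, 0 <= y <= 1 -> `|V y| <= B) -> forall y, 0 <= y <= 1 ->
  `|P y| <= K * B * y /\ `|P y - X 0 * r 0 * y| <= K * B * y ^+ 2.
Proof.
have [cr cr0 rB] := ac_bounded ar; have [c1 c10 r1B] := ac_bounded ar1.
have [cp cp0 epB] := ac_bounded ac_ep; have [cm cm0 emB] := ac_bounded ac_em.
have [a1 [a2 [aa _]]] := amplitude_ac; have [ca ca0 aB] := ac_bounded aa.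
pose K0 := ca / `|E - 1|.
have K00 : 0 <= K0 by rewrite divr_ge0.
pose D := cm * (K0 + cp * cr) + cp * (K0 + cm * cr).
have D0 : 0 <= D by rewrite addr_ge0// mulr_ge0// addr_ge0// mulr_ge0.
pose K1 := cr * (cr * (D + 1)) + c1 * K0.
have K10 : 0 <= K1 by rewrite !(addr_ge0, mulr_ge0).
have crD : 0 <= cr * D by rewrite mulr_ge0.
exists (cr * D + K1); first by rewrite addr_ge0.
move=> V X P B sys VB; have [aP aX P0 P1] := sys; have IV := stream_L1 sys.
have I0 : 0 <= (0 : R) <= 1 by rewrite lexx ler01.
have B0 : 0 <= B by rewrite (le_trans _ (VB _ I0)).
have X0 : `|X 0| <= K0 * B.
  rewrite /K0 mulrAC ler_pdivlMr ?normr_gt0 ?E1_neq0// -normrM mulrC.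
  rewrite (stream_boundary sys) -[leRHS]mulr1 -[X in _ * X]subr0.
  apply: norm_itg_cst => //.
    have := L1B (acML1 ac_ep IV) (L1Z E (acML1 ac_em IV)).
    by congr L1; apply/funext => y; rewrite /amplitude /ep /em; ring.
  by move=> y yI; rewrite normrM ler_pM// ?aB// VB.
have U1 y : 0 <= y <= 1 -> `|ep y * (X y - P y)| <= (K0 + cp * cr) * B.
  move=> yI; have /andP[y0 y1] := yI.
  have := ac_incr (ac_outgoing sys) (lexx 0) y0 y1.
  rewrite P0 ep0 subr0 mul1r => /eqP; rewrite subr_eq => /eqP ->.
  rewrite (le_trans (ler_normD _ _))// addrC mulrDl lerD//.
  apply: (@le_trans _ _ (cp * cr * B * (y - 0))); last first.
    by rewrite subr0 ler_piMr// !mulr_ge0.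
  apply: norm_itg_cst => //; first exact: acML1 ac_ep IV.
  move=> z /andP[z0 zy]; have zI : 0 <= z <= 1 by rewrite z0 (le_trans zy).
  by rewrite !normrM -mulrA ler_pM ?mulr_ge0// ?epB// ler_pM// ?rB// VB.
have U2 y : 0 <= y <= 1 -> `|em y * (X y + P y)| <= (K0 + cm * cr) * B.
  move=> yI; have /andP[y0 y1] := yI.
  have := ac_incr (ac_incoming sys) (lexx 0) y0 y1.
  rewrite P0 em0 addr0 mul1r => /eqP; rewrite subr_eq => /eqP ->.
  rewrite (le_trans (ler_normD _ _))// addrC mulrDl lerD//.
  apply: (@le_trans _ _ (cm * cr * B * (y - 0))); last first.
    by rewrite subr0 ler_piMr// !mulr_ge0.
  apply: norm_itg_cst => //; first exact: acML1 ac_em IV.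
  move=> z /andP[z0 zy]; have zI : 0 <= z <= 1 by rewrite z0 (le_trans zy).
  by rewrite !normrM -mulrA ler_pM ?mulr_ge0// ?emB// ler_pM// ?rB// VB.
have XP y : 0 <= y <= 1 -> `|X y| <= D * B /\ `|P y| <= D * B.
  move=> yI.
  have H1 : `|X y - P y| <= cm * (K0 + cp * cr) * B.
    rewrite (_ : X y - P y = em y * (ep y * (X y - P y))).
      by rewrite normrM -mulrA ler_pM// ?emB// U1.
    by rewrite mulrA (mulrC (em y)) epem mul1r.
  have H2 : `|X y + P y| <= cp * (K0 + cm * cr) * B.
    rewrite (_ : X y + P y = ep y * (em y * (X y + P y))).
      by rewrite normrM -mulrA ler_pM// ?epB// U2.
    by rewrite mulrA epem mul1r.
  have : `|X y - P y| + `|X y + P y| <= D * B by rewrite /D mulrDl lerD.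
  have := ler_normD (X y - P y) (X y + P y).
  have := ler_normB (X y + P y) (X y - P y).
  rewrite (_ : X y + P y - (X y - P y) = 2 * P y); last by ring.
  rewrite (_ : X y - P y + (X y + P y) = 2 * X y); last by ring.
  rewrite !normrM (ger0_norm (ler0n _ 2)).
  by have := normr_ge0 (X y); have := normr_ge0 (P y); split; lra.
move=> y yI; have /andP[y0 y1] := yI.
have KB : 0 <= B * y by rewrite mulr_ge0.
split.
  have := ac_incr aP (lexx 0) y0 y1; rewrite P0 subr0 => ->.
  apply: (@le_trans _ _ (cr * (D * B) * (y - 0))).
    apply: norm_itg_cst => //; first by case: aP.
    move=> z /andP[z0 zy]; have zI : 0 <= z <= 1 by rewrite z0 (le_trans zy).
    by rewrite normrM ler_pM// ?rB//; have [] := XP z zI.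
  by rewrite subr0 mulrA -!mulrA !mulrA -!(mulrA _ B) ler_wpM2r// lerDl.
have E1 : P y - X 0 * r 0 * y = itg 0 y (fun z => r z * X z - X 0 * r 0).
  rewrite itgB//; [|by case: aP|exact: L1_cst].
  by rewrite itg_cst// subr0 -(ac_incr aP)// P0 subr0.
rewrite E1; apply: (@le_trans _ _ (K1 * B * y * (y - 0))); last first.
  rewrite subr0 -mulrA -expr2 -!mulrA; apply: ler_wpM2r.
    by rewrite mulr_ge0// sqr_ge0.
  by rewrite lerDr.
apply: norm_itg_cst => //.
  by apply: L1B; [case: aP|exact: L1_cst].
move=> z /andP[z0 zy]; have zI : 0 <= z <= 1 by rewrite z0 (le_trans zy).
have [_ z1] := andP zI.
have rz : `|r z - r 0| <= c1 * y.
  rewrite (ac_incr ar (lexx 0) z0 z1).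
  apply: (@le_trans _ _ (c1 * (z - 0))); last by rewrite subr0 ler_wpM2l.
  apply: norm_itg_cst => //; first by case: ar.
  by move=> x /andP[x0 xz]; apply: r1B; rewrite x0 (le_trans xz).
have Xz : `|X z - X 0| <= cr * (D + 1) * B * y.
  rewrite (ac_incr aX (lexx 0) z0 z1).
  apply: (@le_trans _ _ (cr * (D + 1) * B * (z - 0))).
    apply: norm_itg_cst => //; first by case: aX.
    move=> x /andP[x0 xz]; have xI : 0 <= x <= 1 by rewrite x0 (le_trans xz).
    rewrite normrM -mulrA ler_pM// ?rB// mulrDl mul1r.
    by rewrite (le_trans (ler_normD _ _))// lerD// ?VB//; have [] := XP x xI.
  by rewrite subr0 ler_wpM2l// !mulr_ge0// addr_ge0.
rewrite (_ : _ - _ = r z * (X z - X 0) + (r z - r 0) * X 0); last by ring.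
rewrite (le_trans (ler_normD _ _))// !normrM /K1 !mulrDl lerD//.
  by rewrite -!mulrA ler_pM// ?rB// (le_trans Xz)// !mulrA.
rewrite (_ : c1 * K0 * B * y = c1 * y * (K0 * B)); last by ring.
by rewrite ler_pM.
Qed.

End StreamFunction.

(** * The stream function near the boundary for large times *)

Section Mode.
Context {R : realType}.
Implicit Types (f g F G W V X P : R -> R) (a b c x y l B K M : R).
Local Notation mu := (@lebesgue_measure R).
Local Notation I01 := `[0%R : R, 1%R : R]%classic.

Lemma H2_bounded_ge0 W B : H2_bounded W B -> 0 <= B.
Proof.
move=> [W1 [w2 [_ _ WB _ _]]].
by rewrite (le_trans _ (WB 0 _))// lexx ler01.
Qed.

Lemma H2_boundedN W B : H2_bounded W B -> H2_bounded (fun y => - W y) B.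
Proof.
move=> [W1 [w2 [aW aW1 WB W1B w2B]]].
exists (fun y => - W1 y), (fun y => - w2 y); split.
- by apply: ac_eq (acZ (-1) aW) => [x _|x]; rewrite mulN1r.
- by apply: ac_eq (acZ (-1) aW1) => [x _|x]; rewrite mulN1r.
- by move=> y yI; rewrite normrN WB.
- by move=> y yI; rewrite normrN W1B.
- by rewrite (@eq_itg _ _ _ _ (fun y => `|w2 y|))// => y _; rewrite normrN.
Qed.

(** The real part of [exp (- i l y) (U + i U')]; the imaginary part is
    [rot l U' (- U)]. *)
Definition rot l (U U' : R -> R) y : R := cos (l * y) * U y + sin (l * y) * U' y.

(** The real and imaginary parts of the equations
    [P' = r v + i l P] and [v' = r (P + W) + i l v]. *)
Definition mode (r : R -> R) l (Wr Wi Pr Pi : R -> R) : Prop :=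
  exists vr vi : R -> R,
  [/\ ac Pr (fun y => r y * vr y - l * Pi y),
      ac Pi (fun y => r y * vi y + l * Pr y),
      ac vr (fun y => r y * (Pr y + Wr y) - l * vi y),
      ac vi (fun y => r y * (Pi y + Wi y) + l * vr y) &
      [/\ Pr 0 = 0, Pr 1 = 0, Pi 0 = 0 & Pi 1 = 0]].

(** Multiplication by [- i] exchanges the two components, so that statements about
    one of them are enough. *)
Lemma mode_mulNi r l Wr Wi Pr Pi : mode r l Wr Wi Pr Pi ->
  mode r l Wi (fun y => - Wr y) Pi (fun y => - Pr y).
Proof.
move=> [vr [vi [aPr aPi avr avi [Pr0 Pr1 Pi0 Pi1]]]].
exists vi, (fun y => - vr y); split.
- by apply: ac_eq aPi => [//|y]; ring.
- by apply: ac_eq (acZ (-1) aPr) => [y _|y]; ring.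
- by apply: ac_eq avi => [//|y]; ring.
- by apply: ac_eq (acZ (-1) avr) => [y _|y]; ring.
- by split => //; rewrite ?Pr0 ?Pr1 oppr0.
Qed.

Lemma ac_rot l U U' u u' : ac U u -> ac U' u' ->
  ac (rot l U U') (fun y => rot l (fun y => u y + l * U' y) (fun y => u' y - l * U y) y).
Proof.
move=> aU aU'.
apply: ac_eq (acD (acM (ac_cos l) aU) (acM (ac_sin l) aU')) => [//|y].
by rewrite /rot; ring.
Qed.

(** Multiplication by [exp (- i l y)] removes the terms [i l P] and [i l v]. *)
Lemma mode_rot r l Wr Wi Pr Pi : mode r l Wr Wi Pr Pi ->
  exists X, stream_system r (rot l Wr Wi) X (rot l Pr Pi).
Proof.
move=> [vr [vi [aPr aPi avr avi [Pr0 Pr1 Pi0 Pi1]]]].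
exists (rot l vr vi); split.
- by apply: ac_eq (ac_rot l aPr aPi) => [//|y]; rewrite /rot; ring.
- by apply: ac_eq (ac_rot l avr avi) => [//|y]; rewrite /rot; ring.
- by rewrite /rot Pr0 Pi0 !mulr0 addr0.
- by rewrite /rot Pr1 Pi1 !mulr0 addr0.
Qed.

Lemma norm_rot l (U U' : R -> R) B B' y : `|U y| <= B -> `|U' y| <= B' ->
  `|rot l U U' y| <= B + B'.
Proof.
move=> UB U'B; rewrite /rot (le_trans (ler_normD _ _))// lerD// normrM.
  by rewrite (le_trans _ UB)// ler_piMl// norm_cos.
by rewrite (le_trans _ U'B)// ler_piMl// norm_sin.
Qed.

Lemma norm_sin_le x : `|sin x| <= `|x|.
Proof.
have := @derive_lipschitz R sin cos `|x| 1 (@is_derive_sin R) (fun y _ => norm_cos y).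
by move=> /(_ 0 x); rewrite normr0 sin0 !subr0 mul1r; apply.
Qed.

Lemma norm_cosB1_le x : `|cos x - 1| <= `|x|.
Proof.
have Ns y : `|y| <= `|x| -> `|- sin y| <= 1 by rewrite normrN norm_sin.
have := derive_lipschitz (@is_derive_cos R) Ns.
by move=> /(_ 0 x); rewrite normr0 cos0 !subr0 mul1r; apply.
Qed.

Variables (r r1 r2 : R -> R).
Hypotheses (ar : ac r r1) (ar1 : ac r1 r2) (S0 : itg 0 1 r != 0).

Lemma amplitude_product : exists2 M, 0 <= M & forall W B, H2_bounded W B ->
  exists A1 A2 : R -> R, [/\ ac (fun y => amplitude r y * W y) A1, ac A1 A2,
    forall y, 0 <= y <= 1 -> `|A1 y| <= M * B &
    itg 0 1 (fun y => `|A2 y|) <= M * B].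
Proof.
have [a1 [a2 [aa aa1]]] := amplitude_ac ar ar1.
have [c0 c00 aB] := ac_bounded aa; have [c1 c10 a1B] := ac_bounded aa1.
have [Ia2 _] := aa1.
pose c2 := itg 0 1 (fun y => `|a2 y|).
have c20 : 0 <= c2 by apply: itg_ge0.
exists (c2 + 2 * c1 + c0); first by rewrite !addr_ge0// mulr_ge0.
move=> W B HW; have B0 := H2_bounded_ge0 HW.
have [W1 [w2 [aW aW1 WB W1B w2B]]] := HW; have [Iw2 _] := aW1.
exists (fun y => a1 y * W y + amplitude r y * W1 y),
  (fun y => (a2 y * W y + a1 y * W1 y) + (a1 y * W1 y + amplitude r y * w2 y)); split.
- exact: acM aa aW.
- exact: acD (acM aa1 aW) (acM aa aW1).
- move=> y yI; rewrite (le_trans (ler_normD _ _))// (normrM (a1 y)) (normrM (amplitude r y)).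
  apply: (@le_trans _ _ (c1 * B + c0 * B)).
    by apply: lerD; apply: ler_pM => //; auto.
  by rewrite -mulrDl ler_wpM2r//; lra.
have I1 : L1 (fun y => B * `|a2 y| + (2 * c1 * B + c0 * `|w2 y|)).
  apply: L1D; first by apply: L1Z; exact: L1_norm.
  by apply: L1D; [exact: L1_cst|apply: L1Z; exact: L1_norm].
have I2 : L1 (fun y => (a2 y * W y + a1 y * W1 y) + (a1 y * W1 y + amplitude r y * w2 y)).
  by case: (acD (acM aa1 aW) (acM aa aW1)).
apply: (@le_trans _ _ (itg 0 1 (fun y => B * `|a2 y| + (2 * c1 * B + c0 * `|w2 y|)))).
  apply: le_itg => //; first exact: L1_norm.
  move=> y yI.
  have H1 : `|a2 y * W y| <= B * `|a2 y|.
    by rewrite normrM mulrC ler_wpM2r// WB.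
  have H2 : `|a1 y * W1 y| <= c1 * B by rewrite normrM ler_pM//; auto.
  have H3 : `|amplitude r y * w2 y| <= c0 * `|w2 y|.
    by rewrite normrM ler_wpM2r// aB.
  have := ler_normD (a2 y * W y + a1 y * W1 y) (a1 y * W1 y + amplitude r y * w2 y).
  have := ler_normD (a2 y * W y) (a1 y * W1 y).
  have := ler_normD (a1 y * W1 y) (amplitude r y * w2 y).
  lra.
have I3 := L1_norm Ia2; have I4 := L1_norm Iw2.
rewrite itgD//; [|exact: L1Z|by apply: L1D; [exact: L1_cst|exact: L1Z]].
rewrite itgD//; [|exact: L1_cst|exact: L1Z].
rewrite itg_cst// !itgZ// subr0 mulr1 -/c2.
have := ler_wpM2l c00 w2B; lra.
Qed.

(** Only the sine integral of [Wi] in [stream_boundary] has a term of order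
    [1 / l], the boundary term at [0]; the factor [1 - E] of [amplitude0] cancels
    the one of [X 0]. *)
Lemma boundary_velocity : exists2 K, 0 <= K & forall l Wr Wi B X P,
  H2_bounded Wr B -> H2_bounded Wi B ->
  stream_system r (rot l Wr Wi) X P ->
  `|l ^+ 2 * X 0 + l * r 0 * Wi 0| <= K * B.
Proof.
have [M M0 MB] := amplitude_product.
have E1 := E1_neq0 S0.
set E := expR _ in E1.
exists (6 * M / `|E - 1|); first by rewrite divr_ge0// mulr_ge0.
move=> l Wr Wi B X P HWr HWi sys.
have [Ar1 [Ar2 [aAr aAr1 Ar1B Ar2B]]] := MB _ _ HWr.
have [Ai1 [Ai2 [aAi aAi1 Ai1B Ai2B]]] := MB _ _ HWi.
have A1 W : amplitude r 1 * W 1 = 0 by rewrite amplitude1 mul0r.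
have [Or _] := oscillatory_integrals l aAr aAr1 (A1 _) Ar1B Ar2B.
have [_ Oi] := oscillatory_integrals l aAi aAi1 (A1 _) Ai1B Ai2B.
have := stream_boundary ar sys; rewrite -/E.
rewrite (@eq_itg _ _ _ _ (fun y => amplitude r y * Wr y * cos (l * y) +
  amplitude r y * Wi y * sin (l * y))); last by move=> y _; rewrite /rot; ring.
rewrite itgD//; last 2 first.
- by apply: acL1M (ac_cos l) _; exact: ac_L1 aAr.
- by apply: acL1M (ac_sin l) _; exact: ac_L1 aAi.
move: Or Oi; set Cr := itg _ _ _; set Si := itg _ _ _ => Or Oi EX.
rewrite [leRHS]mulrAC ler_pdivlMr ?normr_gt0// -normrM.
rewrite amplitude0 -/E in Oi.
rewrite (_ : _ * (E - 1) = l ^+ 2 * Cr + (l ^+ 2 * Si - l * (r 0 * (1 - E) * Wi 0))).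
  by rewrite (le_trans (ler_normD _ _))//; lra.
rewrite mulrDl -mulrA [X 0 * _]mulrC EX; ring.
Qed.

(** The imaginary part of the stream function is driven by the real part of the
    vorticity at the boundary, as the velocity at [0] is [i W 0 / l] times
    [r 0] to leading order. *)
Lemma mode_bound : exists2 K, 0 <= K & forall l Wr Wi Pr Pi B,
  H2_bounded Wr B -> H2_bounded Wi B -> mode r l Wr Wi Pr Pi ->
  forall y, 0 <= y <= 1 -> `|Pi y| <= K * B * y /\
  `|l ^+ 2 * Pi y - l * r 0 ^+ 2 * Wr 0 * y|
     <= K * B * (l ^+ 2 * (1 + `|l|) * y ^+ 2 + y).
Proof.
have [K1 K10 K1B] := stream_bound ar ar1 S0.
have [K2 K20 K2B] := boundary_velocity.
exists (4 * K1 + `|r 0| * K2); first by rewrite addr_ge0// mulr_ge0.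
move=> l Wr Wi Pr Pi B HWr HWi Hm y yI; have /andP[y0 y1] := yI.
have B0 := H2_bounded_ge0 HWr; have HWr' := H2_boundedN HWr.
have [Xr sysr] := mode_rot Hm; have [Xi sysi] := mode_rot (mode_mulNi Hm).
have Wb W : H2_bounded W B -> forall y, 0 <= y <= 1 -> `|W y| <= B.
  by move=> [? [? []]].
have Vr z : 0 <= z <= 1 -> `|rot l Wr Wi z| <= B + B.
  by move=> zI; apply: norm_rot; apply: Wb zI.
have Vi z : 0 <= z <= 1 -> `|rot l Wi (fun y => - Wr y) z| <= B + B.
  by move=> zI; apply: norm_rot; [exact: Wb zI|exact: (Wb _ HWr')].
have [Qr _] := K1B _ _ _ _ sysr Vr y yI.
have [Qi Qi2] := K1B _ _ _ _ sysi Vi y yI.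
have XB := K2B _ _ _ _ _ _ HWi HWr' sysi.
move: Qr Qi Qi2; set qr := rot l Pr Pi y; set qi := rot _ _ _ y => Qr Qi Qi2.
have PE : Pi y = cos (l * y) * qi + sin (l * y) * qr.
  rewrite /qi /qr /rot -[LHS]mul1r -(cos2Dsin2 (l * y)); ring.
have ly : `|l * y| = `|l| * y by rewrite normrM (ger0_norm y0).
set Q := K1 * (B + B) * y in Qr Qi.
have Q0 : 0 <= Q by rewrite (le_trans _ Qr).
have rK : 0 <= `|r 0| * K2 * B * y by rewrite !mulr_ge0.
have KBy : 0 <= K1 * B * y by rewrite !mulr_ge0.
split.
  rewrite PE (le_trans (ler_normD _ _))// !normrM.
  have H1 : `|cos (l * y)| * `|qi| <= Q.
    by rewrite (le_trans _ Qi)// ler_piMl// norm_cos.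
  have H2 : `|sin (l * y)| * `|qr| <= Q.
    by rewrite (le_trans _ Qr)// ler_piMl// norm_sin.
  by move: H1 H2; rewrite /Q; lra.
have H1 : `|(cos (l * y) - 1) * qi| <= `|l| * y * Q.
  by rewrite normrM ler_pM// -ly norm_cosB1_le.
have H2 : `|sin (l * y) * qr| <= `|l| * y * Q.
  by rewrite normrM ler_pM// -ly norm_sin_le.
have H3 : `|(l ^+ 2 * Xi 0 - l * r 0 * Wr 0) * (r 0 * y)| <= K2 * B * (`|r 0| * y).
  rewrite normrM normrM (ger0_norm y0) ler_wpM2r ?mulr_ge0//.
  by move: XB; rewrite mulrN.
have -> : l ^+ 2 * Pi y - l * r 0 ^+ 2 * Wr 0 * y =
  l ^+ 2 * (qi - Xi 0 * r 0 * y + (cos (l * y) - 1) * qi + sin (l * y) * qr)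
  + (l ^+ 2 * Xi 0 - l * r 0 * Wr 0) * (r 0 * y) by rewrite PE; ring.
rewrite (le_trans (ler_normD _ _))// normrM (ger0_norm (sqr_ge0 l)).
have H4 : `|qi - Xi 0 * r 0 * y + (cos (l * y) - 1) * qi + sin (l * y) * qr|
    <= K1 * (B + B) * y ^+ 2 + `|l| * y * Q + `|l| * y * Q.
  by rewrite (le_trans (ler_normD _ _))// lerD// (le_trans (ler_normD _ _))// lerD.
have := ler_wpM2l (sqr_ge0 l) H4.
have K4 : 0 <= (K1 * B * y ^+ 2) * l ^+ 2 by rewrite mulr_ge0 ?sqr_ge0// mulr_ge0 ?sqr_ge0// mulr_ge0.
have rK' : 0 <= (`|r 0| * K2 * B) * (l ^+ 2 * (1 + `|l|) * y ^+ 2).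
  apply: mulr_ge0; first by rewrite !mulr_ge0.
  by rewrite mulr_ge0 ?sqr_ge0// mulr_ge0 ?sqr_ge0// addr_ge0.
rewrite /Q; lra.
Qed.

End Mode.

(** * Logarithmic growth of the slope at the boundary *)

Section Evolution.
Context {R : realType}.
Implicit Types (f g F G W V X P : R -> R) (a b c h t x y l B C K M : R).

Lemma ler_small x y C : (forall h, 0 < h <= 1 -> x <= y + C * h) -> x <= y.
Proof.
move=> H; apply/ler_addgt0Pr => e e0.
have C1 : 0 < `|C| + 1 by rewrite ltr_wpDl.
pose h := Num.min 1 (e / (`|C| + 1)).
have h0 : 0 < h by rewrite lt_min ltr01 divr_gt0.
have h1 : h <= 1 by rewrite ge_min lexx.
have he : h * (`|C| + 1) <= e by rewrite -ler_pdivlMr// ge_min lexx orbT.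
have := H h; rewrite h0 h1 => /(_ isT) /le_trans; apply.
rewrite lerD2l (le_trans _ he)// mulrC ler_wpM2l ?(ltW h0)//.
by rewrite (le_trans (ler_norm C))// lerDl.
Qed.

Lemma is_derive_scale c F t l : is_derive t 1 F l ->
  is_derive t 1 (fun u => c * F u) (c * l).
Proof. by move=> dF; exact: (@is_deriveZ _ _ R^o F c t 1 l dF). Qed.

Lemma is_derive_inv t : t != 0 -> is_derive t 1 (fun u : R => u^-1) (- t^-1 ^+ 2).
Proof.
move=> t0; have d := @derivable_id R R^o t 1; split.
  exact: (@derivableV _ _ id).
by rewrite (@deriveV _ _ id)// derive_id [LHS]mulr1 exprVn.
Qed.

Lemma derive_dominated G (G' : R -> R) (b b' : R -> R) x y : x <= y ->
  (forall t, x <= t <= y -> is_derive t 1 G (G' t)) ->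
  (forall t, x <= t <= y -> is_derive t 1 b (b' t)) ->
  (forall t, x <= t <= y -> `|G' t| <= b' t) -> `|G y - G x| <= b y - b x.
Proof.
move=> xy dG db Gb.
have key F (F' : R -> R) : (forall t, x <= t <= y -> is_derive t 1 F (F' t)) ->
    (forall t, x <= t <= y -> 0 <= F' t) -> F x <= F y.
  move=> dF F0.
  have [z|z|z zI E] := @MVT_segment _ F F' x y xy.
  - by rewrite in_itv/= => /andP[? ?]; apply: dF; rewrite !ltW.
  - apply: derivable_within_continuous => u; rewrite in_itv/= => uI.
    by have [] := dF _ uI.
  - by rewrite -subr_ge0 E mulr_ge0 ?subr_ge0// F0.
have H1 : b x - G x <= b y - G y.
  apply: (key (fun t => b t - G t) (fun t => b' t - G' t)) => t tI.
    by apply: is_deriveB; [exact: db|exact: dG].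
  by rewrite subr_ge0 (le_trans (ler_norm _) (Gb _ tI)).
have H2 : b x + G x <= b y + G y.
  apply: (key (fun t => b t + G t) (fun t => b' t + G' t)) => t tI.
    by apply: is_deriveD; [exact: db|exact: dG].
  by have := Gb _ tI; rewrite ler_norml => /andP[? _]; lra.
by rewrite ler_norml; apply/andP; split; lra.
Qed.

Lemma H2_bounded_itg W B h : H2_bounded W B -> 0 <= h <= 1 ->
  `|itg 0 h W - h * W 0| <= B * h ^+ 2.
Proof.
move=> HW /andP[h0 h1]; have B0 := H2_bounded_ge0 HW.
have [W1 [w2 [aW aW1 WB W1B _]]] := HW; have IW := ac_L1 aW.
have -> : itg 0 h W - h * W 0 = itg 0 h (fun y => W y - W 0).
  by rewrite itgB// ?itg_cst//; [ring|exact: L1_cst].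
rewrite expr2 mulrA -[X in _ * X](subr0 h).
apply: norm_itg_cst => //; first by apply: L1B => //; exact: L1_cst.
move=> y /andP[y0 yh]; have y1 := le_trans yh h1.
rewrite (ac_incr aW (lexx 0) y0 y1) (@le_trans _ _ (B * (y - 0)))//.
  apply: norm_itg_cst => //; first exact: ac_L1 aW1.
  by move=> z /andP[z0 zy]; apply: W1B; rewrite z0 (le_trans zy).
by rewrite subr0 ler_wpM2l.
Qed.

Variables (r r1 r2 f f1 : R -> R) (k Lf : R).
Hypotheses (ar : ac r r1) (ar1 : ac r1 r2) (S0 : itg 0 1 r != 0) (r0 : r 0 != 0).
Hypotheses (k0 : k != 0) (af : ac f f1) (f0 : f 0 != 0).
Hypothesis fL : forall y, 0 <= y <= 1 -> `|f y - f 0| <= Lf * y.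

Variables (Wr Wi Pr Pi J : R -> R -> R) (B : R).
Hypothesis HWr : forall t, 0 <= t -> H2_bounded (Wr t) B.
Hypothesis HWi : forall t, 0 <= t -> H2_bounded (Wi t) B.
Hypothesis Hm : forall t, 0 <= t -> mode r (k * t) (Wr t) (Wi t) (Pr t) (Pi t).
Hypothesis JE : forall h t, 0 <= h <= 1 -> 0 <= t -> J h t = itg 0 h (Wr t).
Hypothesis dJ : forall h t, 0 <= h <= 1 -> 0 <= t ->
  is_derive t 1 (J h) (- itg 0 h (fun y => f y / k * Pi t y)).

Let B0 : 0 <= B. Proof. exact: H2_bounded_ge0 (HWr (lexx 0)). Qed.

Let J_trace h t : 0 <= h <= 1 -> 0 <= t -> `|J h t - h * Wr t 0| <= B * h ^+ 2.
Proof. by move=> hI t0; rewrite JE//; exact: H2_bounded_itg (HWr t0) hI. Qed.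

Let ac_Pi t : 0 <= t -> exists p, ac (Pi t) p.
Proof. by move=> /Hm[vr [vi [_ aPi _ _ _]]]; eexists; exact: aPi. Qed.

Let L1_fPi t : 0 <= t -> L1 (fun y => f y / k * Pi t y).
Proof.
move=> /ac_Pi[p ap]; have := L1Z k^-1 (ac_L1 (acM af ap)).
by congr L1; apply/funext => y; ring.
Qed.

(** The stream function vanishes at the boundary, so that the boundary value of
    the vorticity does not move. *)
Lemma trace_conserved t : 0 <= t -> Wr t 0 = Wr 0 0.
Proof.
move=> t0; have [K K0 HK] := mode_bound ar ar1 S0.
have [cf cf0 fB] := ac_bounded af.
pose C := cf / `|k| * (K * B).
have C0 : 0 <= C by rewrite !mulr_ge0 ?invr_ge0.
apply/eqP; rewrite -subr_eq0 -normr_le0.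
apply: (@ler_small _ _ (C * t + 2 * B)) => h /andP[h0 h1]; rewrite add0r.
have hI : 0 <= h <= 1 by rewrite ltW.
have J1 := J_trace hI t0; have J2 := J_trace hI (lexx 0).
have J3 : `|J h t - J h 0| <= C * h ^+ 2 * t - C * h ^+ 2 * 0.
  apply: (@derive_dominated _ _ (fun u => C * h ^+ 2 * u) (fun=> C * h ^+ 2) 0 t t0).
  - by move=> u /andP[u0 _]; exact: dJ.
  - move=> u _; rewrite -[X in is_derive _ _ _ X]mulr1.
    by apply: is_derive_scale; exact: (@is_derive_id R R^o u 1).
  move=> u /andP[u0 _]; rewrite normrN expr2 mulrA -[X in _ * X](subr0 h).
  apply: norm_itg_cst => //; [exact: ltW|exact: L1_fPi|].
  move=> y /andP[y0 yh]; have yI : 0 <= y <= 1 by rewrite y0 (le_trans yh).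
  have [PB _] := HK _ _ _ _ _ _ (HWr u0) (HWi u0) (Hm u0) y yI.
  rewrite normrM normf_div /C -mulrA ler_pM// ?ler_wpM2r ?invr_ge0 ?fB//.
  by rewrite (le_trans PB)// ler_wpM2l// mulr_ge0.
rewrite -(ler_pM2l h0) -{1}(gtr0_norm h0) -normrM.
have -> : h * (Wr t 0 - Wr 0 0) =
  (J h t - J h 0) - (J h t - h * Wr t 0) + (J h 0 - h * Wr 0 0) by ring.
rewrite (le_trans (ler_normD _ _))//.
by have := ler_normB (J h t - J h 0) (J h t - h * Wr t 0); lra.
Qed.

(** The bound [mode_bound], integrated over [0, h]. The term
    in [h ^ 2 / t] is the drift; one error is of higher order in [h] and the other is
    integrable in time. *)
Lemma derive_bound : exists2 C, 0 <= C & forall h t, 0 <= h <= 1 -> 1 <= t ->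
  `|- itg 0 h (fun y => f y / k * Pi t y)
    + f 0 * r 0 ^+ 2 * Wr 0 0 / (2 * k ^+ 2) * h ^+ 2 * t^-1|
  <= C * ((1 + t) * h ^+ 3 + h ^+ 2 * t^-1 ^+ 2).
Proof.
have [K K0 HK] := mode_bound ar ar1 S0.
have I0 : 0 <= (1 : R) <= 1 by rewrite ler01 lexx.
have Lf0 : 0 <= Lf by rewrite -[Lf]mulr1 (le_trans _ (fL I0)).
have k1 : 0 < `|k| by rewrite normr_gt0.
have k2 : 0 < k ^+ 2 by rewrite exprn_even_gt0//= k0.
pose C := `|k|^-1 * (Lf * (K * B) + `|f 0| * (K * B) * (1 + `|k| + (k ^+ 2)^-1)).
have KB : 0 <= K * B by rewrite mulr_ge0.
have C0 : 0 <= C.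
  rewrite mulr_ge0 ?invr_ge0// addr_ge0 ?mulr_ge0//.
  by rewrite !addr_ge0// invr_ge0 ltW.
exists C => // h t hI t1; have /andP[h0 h1] := hI.
have t0 : 0 < t by rewrite (lt_le_trans ltr01).
have tn : t != 0 by rewrite gt_eqF.
(* [m y] is the leading part of [f y / k * Pi t y]. *)
pose m := f 0 * r 0 ^+ 2 * Wr 0 0 / (k ^+ 2 * t).
have Ih : itg 0 h (fun y => y) = h ^+ 2 / 2.
  have := ac_incr (acM (@ac_id R) (@ac_id R)) (lexx 0) h0 h1.
  rewrite (@eq_itg _ _ _ _ (fun x => 2 * x)) => [|y _]; last by ring.
  by rewrite itgZ//; [rewrite mulr0 subr0; lra|exact: ac_L1 (@ac_id R)].
have Iid : L1 (fun y : R => m * y) by apply: L1Z; exact: ac_L1 (@ac_id R).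
have -> : - itg 0 h (fun y => f y / k * Pi t y)
    + f 0 * r 0 ^+ 2 * Wr 0 0 / (2 * k ^+ 2) * h ^+ 2 * t^-1 =
    - itg 0 h (fun y => f y / k * Pi t y - m * y).
  rewrite itgB//; last exact: L1_fPi (ltW t0).
  rewrite (itgZ m)// ?Ih; last exact: ac_L1 (@ac_id R).
  by rewrite /m; field; rewrite k0 tn.
rewrite normrN.
have -> : C * ((1 + t) * h ^+ 3 + h ^+ 2 * t^-1 ^+ 2) =
    C * ((1 + t) * h ^+ 2 + h * t^-1 ^+ 2) * (h - 0) by ring.
apply: norm_itg_cst => //; first by apply: L1B => //; exact: L1_fPi (ltW t0).
move=> y /andP[y0 yh]; have yI : 0 <= y <= 1 by rewrite y0 (le_trans yh).
have [P1 P2] := HK _ _ _ _ _ _ (HWr (ltW t0)) (HWi (ltW t0)) (Hm (ltW t0)) y yI.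
rewrite (trace_conserved (ltW t0)) in P2.
have kt2 : 0 < (k * t) ^+ 2 by rewrite exprMn mulr_gt0// exprn_gt0.
have {}P2 : `|Pi t y - r 0 ^+ 2 * Wr 0 0 / (k * t) * y| <=
    K * B * ((1 + `|k| * t) * y ^+ 2 + (k ^+ 2)^-1 * t^-1 ^+ 2 * y).
  rewrite -(ler_pM2l kt2) -{1}(ger0_norm (ltW kt2)) -normrM.
  rewrite (_ : _ * (_ - _) = (k * t) ^+ 2 * Pi t y - k * t * r 0 ^+ 2 * Wr 0 0 * y);
    last by field; rewrite k0 tn.
  rewrite (le_trans P2)// le_eqVlt; apply/orP; left; apply/eqP.
  by rewrite normrM (gtr0_norm t0); field; rewrite k0 tn.
rewrite (_ : _ - _ = k^-1 * ((f y - f 0) * Pi t y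
    + f 0 * (Pi t y - r 0 ^+ 2 * Wr 0 0 / (k * t) * y))); last first.
  by rewrite /m; field; rewrite k0 tn.
rewrite normrM normfV /C -[leRHS]mulrA ler_wpM2l ?invr_ge0//.
rewrite (le_trans (ler_normD _ _))// !normrM.
have y2h : y ^+ 2 <= h ^+ 2 by rewrite ler_sqr ?nnegrE.
have T1 : `|f y - f 0| * `|Pi t y| <= Lf * (K * B) * h ^+ 2.
  apply: (@le_trans _ _ (Lf * y * (K * B * y))); first by rewrite ler_pM// fL.
  by rewrite (_ : _ * _ = Lf * (K * B) * y ^+ 2); [rewrite ler_wpM2l// mulr_ge0|ring].
have T2 := ler_wpM2l (normr_ge0 (f 0)) P2.
have ti : 0 <= t^-1 ^+ 2 by rewrite sqr_ge0.
have ki : 0 <= (k ^+ 2)^-1 by rewrite invr_ge0 ltW.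
have S1 : (1 + `|k| * t) * y ^+ 2 + (k ^+ 2)^-1 * t^-1 ^+ 2 * y <=
   (1 + `|k| + (k ^+ 2)^-1) * ((1 + t) * h ^+ 2 + h * t^-1 ^+ 2).
  have Q1 : (1 + `|k| * t) * y ^+ 2 <= (1 + `|k|) * ((1 + t) * h ^+ 2).
    have kt : 0 <= `|k| * t by rewrite mulr_ge0// ltW.
    rewrite [leRHS]mulrA; apply: ler_pM; [by rewrite addr_ge0|exact: sqr_ge0| |exact: y2h].
    by have : 0 <= `|k| by []; lra.
  have Q2 : (k ^+ 2)^-1 * t^-1 ^+ 2 * y <= (k ^+ 2)^-1 * (h * t^-1 ^+ 2).
    by rewrite -mulrA (mulrC (t^-1 ^+ 2)) ler_wpM2l// ler_wpM2r.
  have Q3 : 0 <= (1 + `|k|) * (h * t^-1 ^+ 2).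
    by rewrite mulr_ge0 ?addr_ge0// mulr_ge0.
  have Q4 : 0 <= (k ^+ 2)^-1 * ((1 + t) * h ^+ 2).
    by rewrite mulr_ge0// mulr_ge0 ?sqr_ge0// addr_ge0// ltW.
  lra.
have fKB : 0 <= `|f 0| * (K * B) by rewrite mulr_ge0.
have T3 := ler_wpM2l fKB S1.
have T4 : 0 <= Lf * (K * B) * (t * h ^+ 2 + h * t^-1 ^+ 2).
  rewrite mulr_ge0 ?mulr_ge0// addr_ge0// mulr_ge0 ?sqr_ge0//; exact: ltW.
lra.
Qed.

(** The integral of [Wr t] over [0, h] drifts by [- kap h ^ 2 ln t], whereas the
    conserved boundary value and the uniform Lipschitz bound confine it to a
    window of size [O(h ^ 2)]. Hence [kap] vanishes. *)
Lemma no_bounded_evolution : Wr 0 0 = 0.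
Proof.
have [C C0 HC] := derive_bound.
pose kap := f 0 * r 0 ^+ 2 * Wr 0 0 / (2 * k ^+ 2).
have drift T : 1 <= T -> `|kap| * ln T <= 2 * B + C.
  move=> T1; have T0 := lt_le_trans ltr01 T1.
  apply: (@ler_small _ _ (C * (1 + T) * T)) => h /andP[h0 h1].
  have hI : 0 <= h <= 1 by rewrite ltW.
  have J1 := J_trace hI (ltW T0); have J2 := J_trace hI ler01.
  rewrite (trace_conserved (ltW T0)) in J1; rewrite (trace_conserved ler01) in J2.
  have D : `|(J h T + kap * h ^+ 2 * ln T) - (J h 1 + kap * h ^+ 2 * ln 1)| <=
    (C * (1 + T) * h ^+ 3 * T - C * h ^+ 2 * T^-1)
    - (C * (1 + T) * h ^+ 3 * 1 - C * h ^+ 2 * 1^-1).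
    (* The primitive in time of the error bound, with [1 + t <= 1 + T]. *)
    apply: (@derive_dominated (fun t => J h t + kap * h ^+ 2 * ln t)
      (fun t => - itg 0 h (fun y => f y / k * Pi t y) + kap * h ^+ 2 * t^-1)
      (fun t => C * (1 + T) * h ^+ 3 * t - C * h ^+ 2 * t^-1)
      (fun t => C * (1 + T) * h ^+ 3 * 1 - C * h ^+ 2 * - t^-1 ^+ 2)).
    - exact: T1.
    - move=> t /andP[t1 _]; have t0 := lt_le_trans ltr01 t1.
      apply: is_deriveD; first by apply: dJ => //; exact: ltW.
      by apply: is_derive_scale; exact: is_derive1_ln.
    - move=> t /andP[t1 _]; have t0 := lt_le_trans ltr01 t1.
      have tn : t != 0 by rewrite gt_eqF.
      have d1 := is_derive_scale (C * (1 + T) * h ^+ 3) (@is_derive_id R R^o t 1).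
      exact: (is_deriveB d1 (is_derive_scale (C * h ^+ 2) (is_derive_inv tn))).
    - move=> t /andP[t1 tT]; have t0 := lt_le_trans ltr01 t1.
      have h3 : 0 <= h ^+ 3 by rewrite exprn_ge0// ltW.
      have X := ler_wpM2l C0 (ler_wpM2r h3 (lerD (lexx 1) tT)).
      by rewrite (le_trans (HC _ _ hI t1))//; lra.
  rewrite ln1 !mulr0 !addr0 mulr1 invr1 mulr1 in D.
  rewrite -(ler_pM2l (exprn_gt0 2 h0)).
  have lnT : 0 <= ln T by rewrite ln_ge0.
  rewrite (_ : h ^+ 2 * (`|kap| * ln T) = `|kap * h ^+ 2 * ln T|); last first.
    by rewrite (normrM (kap * h ^+ 2)) (normrM kap) (ger0_norm lnT) (ger0_norm (sqr_ge0 h)); ring.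
  rewrite (_ : kap * h ^+ 2 * ln T = (J h T + kap * h ^+ 2 * ln T - J h 1)
    - (J h T - h * Wr 0 0) + (J h 1 - h * Wr 0 0)); last by ring.
  rewrite (le_trans (ler_normD _ _))//.
  have := ler_normB (J h T + kap * h ^+ 2 * ln T - J h 1) (J h T - h * Wr 0 0).
  have X1 : 0 <= C * h ^+ 2 * T^-1.
    by rewrite mulr_ge0 ?invr_ge0 ?(ltW T0)// mulr_ge0// sqr_ge0.
  have X2 : 0 <= C * (1 + T) * h ^+ 3.
    by rewrite mulr_ge0 ?exprn_ge0 ?(ltW h0)// mulr_ge0// addr_ge0// ltW.
  lra.
have kap0 : kap = 0.
  apply/eqP; rewrite -normr_eq0; apply/negP => /negP kn.
  have kp : 0 < `|kap| by rewrite lt_def kn normr_ge0.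
  have D0 : 0 <= 2 * B + C by rewrite addr_ge0// mulr_ge0.
  have x0 : 0 <= (2 * B + C + 1) / `|kap| by rewrite divr_ge0// addr_ge0.
  have e1 : 1 <= expR ((2 * B + C + 1) / `|kap|) by rewrite (le_trans _ (expR_ge1Dx _))// lerDl.
  have := drift _ e1; rewrite expRK.
  have -> : `|kap| * ((2 * B + C + 1) / `|kap|) = 2 * B + C + 1 by field.
  by lra.
move/eqP: kap0; rewrite /kap !mulf_eq0 invr_eq0 mulf_eq0 !expf_eq0/=.
by rewrite (negPf f0) (negPf r0) (negPf k0) pnatr_eq0/= !orbF => /eqP.
Qed.

End Evolution.

(** * From Sobolev functions to continuous representatives *)

Section SobolevRepresentatives.
Context {R : realType}.
Implicit Types (f g F G : R -> R) (u v w : R -> R[i]).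
Implicit Types (a b c h k t x y l B C K M e : R).
Local Notation mu := (@lebesgue_measure R).
Local Notation I01 := `[0%R : R, 1%R : R]%classic.

Lemma ae_imp2 (P Q S : R -> Prop) : (forall x, P x -> Q x -> S x) ->
  {ae mu, forall x, P x} -> {ae mu, forall x, Q x} -> {ae mu, forall x, S x}.
Proof. exact: (@filterS2 _ _ (ae_filter_ringOfSetsType mu)). Qed.

Lemma weak_deriv_continuous_ac F f : {within I01, continuous F} ->
  weak_deriv F f -> ac F f.
Proof.
move=> cF /weak_deriv_ac[G [aG FG]].
have E := ae_eq_continuous cF (ac_cont aG) FG.
by apply: ac_eq aG => // x xI; rewrite E.
Qed.

Lemma W2infty_ac f : W2infty f -> exists f1 f2, ac f f1 /\ ac f1 f2.
Proof.
move=> [cf [f1 [f2 [_ _ _ wf wf1]]]].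
have [G [aG f1G]] := weak_deriv_ac wf1.
exists G, f2; split=> //.
by apply: ac_eq_ae (weak_deriv_continuous_ac cf wf) => //; exact: ac_measurable aG.
Qed.

(** The mean value of [`|F|] differs from any of its values by at most the total
    variation. *)
Lemma ac_sup F f y : ac F f -> 0 <= y <= 1 ->
  `|F y| <= itg 0 1 (fun x => `|F x|) + itg 0 1 (fun x => `|f x|).
Proof.
move=> aF yI; have IF := L1_norm (ac_L1 aF).
set A := itg 0 1 (fun x => `|f x|).
have -> : `|F y| = itg 0 1 (fun=> `|F y|) by rewrite itg_cst// subr0 mulr1.
have EA : itg 0 1 (fun x => `|F x|) + A = itg 0 1 (fun x => `|F x| + A).
  by rewrite itgD// ?itg_cst// ?subr0 ?mulr1//; exact: L1_cst.
rewrite EA; apply: le_itg => //; first exact: L1_cst.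
  by apply: L1D => //; exact: L1_cst.
move=> x xI; have := ac_dist aF xI yI; rewrite -/A.
have := ler_normD (F x) (F y - F x).
by rewrite (_ : F x + (F y - F x) = F y); [lra|ring].
Qed.

Lemma ac_lipschitz0 F f f' : ac F f -> ac f f' ->
  exists C, forall y, 0 <= y <= 1 -> `|F y - F 0| <= C * y.
Proof.
move=> aF af; have [c c0 fc] := ac_bounded af; exists c => y /andP[y0 y1].
rewrite (ac_incr aF (lexx 0) y0 y1) -[X in _ * X](subr0 y).
apply: norm_itg_cst => //; first exact: ac_L1 af.
by move=> x /andP[x0 xy]; apply: fc; rewrite x0 (le_trans xy).
Qed.

Lemma normc_sqr (z : R[i]) : Normc.normc z ^+ 2 = complex.Re z ^+ 2 + complex.Im z ^+ 2.
Proof. by case: z => a b /=; rewrite sqr_sqrtr// addr_ge0// sqr_ge0. Qed.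

Lemma sqL2norm_ge0 u : (0 <= sqL2norm u)%E.
Proof. by apply: integral_ge0 => x _; rewrite lee_fin sqr_ge0. Qed.

(** By the inequality of arithmetic and geometric means, [`|p|] is dominated by
    [(e + |u| ^ 2 / e) / 2]. *)
Lemma sqL2norm_component u (p : R -> R) e : 0 < e ->
  measurable_fun I01 (fun y => complex.Re (u y)) ->
  measurable_fun I01 (fun y => complex.Im (u y)) ->
  (sqL2norm u <= (e ^+ 2)%:E)%E ->
  measurable_fun I01 p -> (forall y, p y ^+ 2 <= Normc.normc (u y) ^+ 2) ->
  L1 p /\ itg 0 1 (fun y => `|p y|) <= e.
Proof.
move=> e0 mR mI ue mp pu.
pose n y := Normc.normc (u y) ^+ 2.
have mn : measurable_fun I01 n.
  rewrite (_ : n = (fun y => complex.Re (u y) ^+ 2 + complex.Im (u y) ^+ 2)).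
    by apply: measurable_funD; apply: measurable_funX.
  by apply/funext => y; exact: normc_sqr.
have n0 y : 0 <= n y by rewrite sqr_ge0.
have In : L1 n.
  apply/integrableP; split; first exact/measurable_EFinP.
  rewrite (@le_lt_trans _ _ (e ^+ 2)%:E)// ?ltry//.
  apply: le_trans ue; rewrite le_eqVlt; apply/orP; left; apply/eqP.
  by apply: eq_integral => x _ /=; rewrite ger0_norm// n0.
have nE : itg 0 1 n <= e ^+ 2.
  by rewrite -lee_fin /itg /Rintegral fineK//; exact: (@integrable_fin_num _ _ _ mu _ mI01 _ In).
pose d y := e / 2 + (2 * e)^-1 * n y.
have Id : L1 d by apply: L1D; [exact: L1_cst|exact: L1Z].
have pd y : `|p y| <= d y.
  have := pu y; rewrite -/(n y) -(ger0_norm (sqr_ge0 (p y))) normrX => pn.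
  rewrite /d -(ler_pM2l (_ : 0 < 2 * e)) ?mulr_gt0//.
  rewrite (_ : 2 * e * (_ + _) = e ^+ 2 + n y); last by field; rewrite gt_eqF.
  by have := sqr_ge0 (e - `|p y|); lra.
have Ip : L1 p.
  apply: (@le_integrable _ _ _ mu _ mI01 _ _ _ _ Id); first exact/measurable_EFinP.
  by move=> y _; rewrite lee_fin (le_trans (pd y))// ler_norm.
split => //.
apply: (@le_trans _ _ (itg 0 1 d)); first by apply: le_itg => //; exact: L1_norm.
rewrite /d itgD//; [|exact: L1_cst|exact: L1Z].
rewrite itg_cst// itgZ// subr0 mulr1.
rewrite -(ler_pM2l (_ : 0 < 2 * e)) ?mulr_gt0//.
rewrite (_ : 2 * e * (_ + _) = e ^+ 2 + itg 0 1 n); last by field; rewrite gt_eqF.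
by lra.
Qed.

Lemma Re_le_normc (z : R[i]) : complex.Re z ^+ 2 <= Normc.normc z ^+ 2.
Proof. by rewrite normc_sqr lerDl sqr_ge0. Qed.

Lemma Im_le_normc (z : R[i]) : complex.Im z ^+ 2 <= Normc.normc z ^+ 2.
Proof. by rewrite normc_sqr lerDr sqr_ge0. Qed.

Lemma poweR_half_le (z : \bar R) e : (0 <= z)%E -> 0 <= e ->
  (poweR z 2^-1 <= e%:E)%E -> (z <= (e ^+ 2)%:E)%E.
Proof.
case: z => [z||//]; last by rewrite poweRyr// leye_eq.
rewrite poweR_EFin !lee_fin => z0 e0; rewrite powR12_sqrt// => ze.
by rewrite -(sqr_sqrtr z0) ler_sqr ?nnegrE ?sqrtr_ge0.
Qed.

Lemma L2_L1 u : L2 u -> L1 (fun y => complex.Re (u y)) /\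
  L1 (fun y => complex.Im (u y)).
Proof.
move=> [mR mI]; rewrite /L2norm => uoo.
have [e e0 ue] : exists2 e, 0 < e & (sqL2norm u <= (e ^+ 2)%:E)%E.
  have := sqL2norm_ge0 u; case E : (sqL2norm u) => [s||]//= s0.
    exists (1 + s); first by rewrite ltr_wpDr.
    by move: s0; rewrite !lee_fin => s0; nra.
  by move: uoo; rewrite E poweRyr.
split.
  have [] := @sqL2norm_component u (fun y => complex.Re (u y)) e e0 mR mI ue mR.
    by move=> y; exact: Re_le_normc.
  by [].
have [] := @sqL2norm_component u (fun y => complex.Im (u y)) e e0 mR mI ue mI.
  by move=> y; exact: Im_le_normc.
by [].
Qed.

Lemma H2_representative (p p1 p2 : R -> R) B : weak_deriv p p1 -> weak_deriv p1 p2 ->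
  itg 0 1 (fun y => `|p y|) <= B -> itg 0 1 (fun y => `|p1 y|) <= B ->
  itg 0 1 (fun y => `|p2 y|) <= B ->
  exists P, H2_bounded P (2 * B) /\ {ae mu, forall y, I01 y -> p y = P y}.
Proof.
move=> wp wp1 pB p1B p2B.
have [P1 [aP1 p1P]] := weak_deriv_ac wp1.
have [P [aP' pP]] := weak_deriv_ac wp.
have aP : ac P P1 by apply: ac_eq_ae aP' => //; exact: ac_measurable aP1.
have [Ip Ip1 _] := wp.
have nrm F G : L1 F -> L1 G -> {ae mu, forall y, I01 y -> F y = G y} ->
    itg 0 1 (fun y => `|G y|) = itg 0 1 (fun y => `|F y|).
  move=> IF IG FG; apply: eq_itg_ae => //.
  - by apply: L1_measurable; exact: L1_norm.
  - by apply: L1_measurable; exact: L1_norm.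
  - by apply: (@filterS _ _ (ae_filter_ringOfSetsType mu) _ _ _ FG) => y /= + yI => ->.
have EP := nrm _ _ Ip (ac_L1 aP) pP; have EP1 := nrm _ _ Ip1 (ac_L1 aP1) p1P.
have B0 : 0 <= B by rewrite (le_trans _ p2B)// itg_ge0.
exists P; split=> //; exists P1, p2; split=> //.
- by move=> y yI; rewrite (le_trans (ac_sup aP yI))// EP EP1; lra.
- by move=> y yI; rewrite (le_trans (ac_sup aP1 yI))// EP1; lra.
- by lra.
Qed.

(** Weak derivatives with norm below [M] exist because the infimum is below [M].
    The bound [2 * M] involves no other property of [u], so that it becomes
    uniform in time for a bounded curve. *)
Lemma H2norm_representatives u M : 0 < M -> (H2norm u < M%:E)%E ->
  exists P Q : R -> R, [/\ H2_bounded P (2 * M), H2_bounded Q (2 * M),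
    {ae mu, forall y, I01 y -> complex.Re (u y) = P y} &
    {ae mu, forall y, I01 y -> complex.Im (u y) = Q y}].
Proof.
move=> M0 /ereal_inf_lt[_ [u1 [u2 [[Lu Lu1 Lu2 [wR wI] [wR1 wI1]] ->]]]] uM.
have s0 := sqL2norm_ge0 u; have s1 := sqL2norm_ge0 u1; have s2 := sqL2norm_ge0 u2.
have sM : (sqL2norm u + sqL2norm u1 + sqL2norm u2 <= (M ^+ 2)%:E)%E.
  apply: poweR_half_le.
  - by apply: adde_ge0 => //; apply: adde_ge0.
  - exact: ltW.
  - exact: (ltW uM).
have b0 : (sqL2norm u <= (M ^+ 2)%:E)%E.
  by apply: le_trans sM; rewrite -addeA leeDl// adde_ge0.
have b1 : (sqL2norm u1 <= (M ^+ 2)%:E)%E.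
  by apply: le_trans sM; rewrite addeAC leeDr// adde_ge0.
have b2 : (sqL2norm u2 <= (M ^+ 2)%:E)%E.
  by apply: le_trans sM; rewrite leeDr// adde_ge0.
have nR v : L2 v -> (sqL2norm v <= (M ^+ 2)%:E)%E ->
    itg 0 1 (fun y => `|complex.Re (v y)|) <= M.
  move=> [mR mI _] vM.
  have [] := @sqL2norm_component v (fun y => complex.Re (v y)) M M0 mR mI vM mR.
    by move=> y; exact: Re_le_normc.
  by [].
have nI v : L2 v -> (sqL2norm v <= (M ^+ 2)%:E)%E ->
    itg 0 1 (fun y => `|complex.Im (v y)|) <= M.
  move=> [mR mI _] vM.
  have [] := @sqL2norm_component v (fun y => complex.Im (v y)) M M0 mR mI vM mI.
    by move=> y; exact: Im_le_normc.
  by [].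
have [P [HP RP]] := H2_representative wR wR1 (nR _ Lu b0) (nR _ Lu1 b1) (nR _ Lu2 b2).
have [Q [HQ IQ]] := H2_representative wI wI1 (nI _ Lu b0) (nI _ Lu1 b1) (nI _ Lu2 b2).
by exists P, Q; split.
Qed.

Lemma Re_shear_op g k t u u1 y : complex.Re (shear_op g k t u u1 y) =
  g y * (k^-1 * complex.Re (u1 y) + t * complex.Im (u y)).
Proof. by rewrite /shear_op; case: (u y) (u1 y) => a b [c d] /=; ring. Qed.

Lemma Im_shear_op g k t u u1 y : complex.Im (shear_op g k t u u1 y) =
  g y * (k^-1 * complex.Im (u1 y) - t * complex.Re (u y)).
Proof. by rewrite /shear_op; case: (u y) (u1 y) => a b [c d] /=; ring. Qed.

Lemma stream_function_mode g k t w Phi (r r1 P Q : R -> R) :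
  k != 0 -> (forall y, 0 <= y <= 1 -> g y != 0) ->
  (forall y, 0 <= y <= 1 -> r y = k / g y) -> ac r r1 ->
  measurable_fun I01 P -> measurable_fun I01 Q ->
  {ae mu, forall y, I01 y -> complex.Re (w y) = P y} ->
  {ae mu, forall y, I01 y -> complex.Im (w y) = Q y} ->
  stream_function g k t w Phi ->
  mode r (k * t) P Q (fun y => complex.Re (Phi y)) (fun y => complex.Im (Phi y)).
Proof.
move=> k0 g0 rE ar mP mQ wP wQ [[cR cI] P0 P1 [Phi1 [v1 /=]]].
set v := shear_op g k t Phi Phi1.
move=> [_ _ [wR wI] [_ [_ [wvR wvI]]] eqn].
have aR := weak_deriv_continuous_ac cR wR; have aI := weak_deriv_continuous_ac cI wI.
have [vr [avr vrE]] := weak_deriv_ac wvR; have [vi [avi viE]] := weak_deriv_ac wvI.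
have mr := ac_measurable ar; have mvr := ac_measurable avr; have mvi := ac_measurable avi.
have mR := ac_measurable aR; have mI := ac_measurable aI.
have I01E y : I01 y -> 0 <= y <= 1 by rewrite /= in_itv.
have mZ (q : R -> R) : measurable_fun I01 q -> measurable_fun I01 (fun y => k * t * q y).
  by move=> mq; apply: measurable_funM.
exists vr, vi; split.
- apply: ac_eq_ae aR.
    by apply: measurable_funB; [exact: measurable_funM|exact: mZ].
  apply: (@filterS _ _ (ae_filter_ringOfSetsType mu) _ _ _ vrE) => y E yI.
  have gy := g0 _ (I01E _ yI).
  by rewrite -(E yI) (rE _ (I01E _ yI)) Re_shear_op; field; rewrite k0 gy.
- apply: ac_eq_ae aI.
    by apply: measurable_funD; [exact: measurable_funM|exact: mZ].
  apply: (@filterS _ _ (ae_filter_ringOfSetsType mu) _ _ _ viE) => y E yI.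
  have gy := g0 _ (I01E _ yI).
  by rewrite -(E yI) (rE _ (I01E _ yI)) Im_shear_op; field; rewrite k0 gy.
- apply: ac_eq_ae avr.
    apply: measurable_funB; last exact: mZ.
    by apply: measurable_funM => //; exact: measurable_funD.
  apply: (@filterS3 _ _ (ae_filter_ringOfSetsType mu) _ _ _ _ _ eqn viE wP).
  move=> y E E1 E2 yI; have gy := g0 _ (I01E _ yI).
  rewrite -(E1 yI) -(E2 yI) -(E yI) (rE _ (I01E _ yI)).
  by rewrite raddfD raddfN/= Re_shear_op; field; rewrite k0 gy.
- apply: ac_eq_ae avi.
    apply: measurable_funD; last exact: mZ.
    by apply: measurable_funM => //; exact: measurable_funD.
  apply: (@filterS3 _ _ (ae_filter_ringOfSetsType mu) _ _ _ _ _ eqn vrE wQ).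
  move=> y E E1 E2 yI; have gy := g0 _ (I01E _ yI).
  rewrite -(E1 yI) -(E2 yI) -(E yI) (rE _ (I01E _ yI)).
  by rewrite raddfD raddfN/= Im_shear_op; field; rewrite k0 gy.
- by rewrite P0 P1.
Qed.

(** Differentiability in L^2 passes to integrals over subintervals; [p] and [q] are
    a component of the curve and of its derivative, [D] the complex-valued
    difference between difference quotient and derivative. *)
Lemma itg_derivative (p : R -> R -> R) (q : R -> R) (D : R -> R -> R[i]) t h :
  0 <= h <= 1 -> (forall s, L1 (p s)) -> L1 q ->
  (forall e, measurable_fun I01 (fun y => complex.Re (D e y)) /\
             measurable_fun I01 (fun y => complex.Im (D e y))) ->
  (forall e y, (e^-1 * (p (t + e) y - p t y) - q y) ^+ 2 <= Normc.normc (D e y) ^+ 2) ->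
  L2norm (D e) @[e --> 0^'] --> 0%E ->
  is_derive t 1 (fun s => itg 0 h (p s)) (itg 0 h q).
Proof.
move=> /andP[h0 h1] Lp Lq mD pD DL.
apply: is_derive_quotient; apply/cvgrPdist_le => e e0.
have : \forall s \near 0^', (L2norm (D s) < e%:E)%E.
  by apply: (DL [set u | (u < e%:E)%E]); apply: open_ereal_lt'; rewrite lte_fin.
apply: filterS => s De.
have Ld : L1 (fun y => s^-1 * (p (t + s) y - p t y) - q y).
  by apply: L1B => //; apply: L1Z; exact: L1B.
have [mR mI] := mD s.
have De2 := poweR_half_le (sqL2norm_ge0 _) (ltW e0) (ltW De).
have [_ De3] := sqL2norm_component e0 mR mI De2 (L1_measurable Ld) (pD s).
rewrite distrC; apply: le_trans De3.
have -> : s^-1 * (itg 0 h (p (t + s)) - itg 0 h (p t)) - itg 0 h q =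
    itg 0 h (fun y => s^-1 * (p (t + s) y - p t y) - q y).
  by rewrite itgB//; [rewrite itgZ ?itgB//; exact: L1B|apply: L1Z; exact: L1B].
exact: norm_itg_full.
Qed.

Lemma Re_residual (a c b : R) (z z' u : R[i]) : complex.Re
  (a%:C * (z - z') - 'i%C * b%:C / c%:C * u) =
  a * (complex.Re z - complex.Re z') - - (b / c * complex.Im u).
Proof.
rewrite -(fmorphV (real_complex R)).
by case: z z' u => z1 z2 [z3 z4] [u1 u2] /=; ring.
Qed.

Lemma Im_residual (a c b : R) (z z' u : R[i]) : complex.Im
  (a%:C * (z - z') - 'i%C * b%:C / c%:C * u) =
  a * (complex.Im z - complex.Im z') - - (b / c * - complex.Re u).
Proof.
rewrite -(fmorphV (real_complex R)).
by case: z z' u => z1 z2 [z3 z4] [u1 u2] /=; ring.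
Qed.

Lemma euler_derivatives (f f1 : R -> R) k t h (W : R -> R -> R[i]) (Phi : R -> R[i]) :
  0 <= h <= 1 -> ac f f1 -> (forall s, L2 (W s)) -> L2 Phi ->
  L2norm (fun y => e^-1%:C * (W (t + e) y - W t y) - 'i%C * (f y)%:C / k%:C * Phi y)
    @[e --> 0^'] --> 0%E ->
  is_derive t 1 (fun s => itg 0 h (fun y => complex.Re (W s y)))
    (- itg 0 h (fun y => f y / k * complex.Im (Phi y))) /\
  is_derive t 1 (fun s => itg 0 h (fun y => complex.Im (W s y)))
    (- itg 0 h (fun y => f y / k * - complex.Re (Phi y))).
Proof.
move=> hI af LW LP DL0.
pose D e y : R[i] := e^-1%:C * (W (t + e) y - W t y) - 'i%C * (f y)%:C / k%:C * Phi y.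
have DL : L2norm (D e) @[e --> 0^'] --> 0%E := DL0.
have [h0 h1] := andP hI.
have [LPR LPI] := L2_L1 LP.
have LR s := (L2_L1 (LW s)).1; have LI s := (L2_L1 (LW s)).2.
have LfP (p : R -> R) : L1 p -> L1 (fun y => f y / k * p y).
  move=> Lp; have := L1Z k^-1 (acML1 af Lp).
  by congr L1; apply/funext => y; ring.
have LfI := LfP _ LPI; have LfR := LfP _ (L1N LPR).
have mD e : measurable_fun I01 (fun y => complex.Re (D e y)) /\
            measurable_fun I01 (fun y => complex.Im (D e y)).
  rewrite (_ : (fun y => complex.Re _) = (fun y => e^-1 * (complex.Re (W (t + e) y)
    - complex.Re (W t y)) - - (f y / k * complex.Im (Phi y)))); last first.
    by apply/funext => y; rewrite Re_residual.
  rewrite (_ : (fun y => complex.Im _) = (fun y => e^-1 * (complex.Im (W (t + e) y)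
    - complex.Im (W t y)) - - (f y / k * - complex.Re (Phi y)))); last first.
    by apply/funext => y; rewrite Im_residual.
  by split; apply: L1_measurable; apply: L1B; try exact: L1N; apply: L1Z; exact: L1B.
split; rewrite -itgN//; apply: (itg_derivative hI _ _ mD _ DL) => //; try exact: L1N.
- by move=> e y; rewrite -Re_residual; exact: Re_le_normc.
- by move=> e y; rewrite -Im_residual; exact: Im_le_normc.
Qed.

Lemma inverse_profile g k c : k != 0 -> W2infty g -> 0 < c ->
  (forall y, 0 <= y <= 1 -> c < g y /\ g y < c^-1) ->
  exists r r1 r2 : R -> R, [/\ forall y, r y = k / g y, ac r r1, ac r1 r2 & itg 0 1 r != 0].
Proof.
move=> k0 /W2infty_ac[g1 [g2 [ag ag1]]] c0 gc.
have ai := ac_inv c0 (fun y yI => ltW (gc y yI).1) ag.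
have ai1 := acM (acM ai ai) ag1; have aZ := acZ k ai.
exists (fun y => k / g y), (fun y => k * (- (g y)^-1 ^+ 2 * g1 y)).
eexists; split.
- by [].
- exact: aZ.
- by apply: ac_eq (acZ (- k) ai1) => [y _|y]; last reflexivity; ring.
rewrite itgZ//; last exact: ac_L1 ai.
rewrite mulf_neq0// gt_eqF// (lt_le_trans c0)//.
have -> : c = itg 0 1 (fun=> c) by rewrite itg_cst// subr0 mulr1.
apply: le_itg => //; [exact: L1_cst|exact: ac_L1 ai|].
move=> y yI; have [g0 gi] := gc y yI.
have gp := lt_trans c0 g0.
by rewrite -(invrK c) lef_pV2 ?posrE ?invr_gt0// ltW.
Qed.

End SobolevRepresentatives.

(** * Blow-up in H^2 *)

Theorem theoremB1 (R : realType) (L : R) (hL : 0 < L)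
    (k : R) (hk : exists n : int, n != 0 /\ k = 2 * pi / L * n%:~R)
    (f g : R -> R) (hf : W2infty f) (hg : W2infty g)
    (hgc : exists c : R, 0 < c /\
             forall y : R, 0 <= y <= 1 -> c < g y /\ g y < c^-1)
    (hf0 : f 0 <> 0) (hf1 : f 1 <> 0)
    (w0 : R -> R[i]) (hw0 : H2 w0) (hw00 : w0 0 <> 0) (hw01 : w0 1 <> 0)
    (W : R -> R -> R[i]) (hW : euler_solution f g k w0 W) :
  ereal_sup [set H2norm (W t) | t in [set t : R | 0 <= t]] = +oo%E.
Proof.
have k0 : k != 0.
  have [n [n0 ->]] := hk.
  rewrite mulf_neq0 ?intr_eq0//.
  by rewrite gt_eqF// divr_gt0// mulr_gt0// pi_gt0.
have [c [c0 gc]] := hgc.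
have [r [r1 [r2 [rE ar ar1 S0]]]] := inverse_profile k0 hg c0 gc.
have g0 y : 0 <= y <= 1 -> g y != 0.
  by move=> /gc[cg _]; rewrite gt_eqF// (lt_trans c0).
have I0 : 0 <= (0 : R) <= 1 by rewrite lexx ler01.
have r0 : r 0 != 0 by rewrite rE mulf_neq0// invr_neq0// g0.
have [f1 [f2 [af af1]]] := W2infty_ac hf; have [Lf fL] := ac_lipschitz0 af af1.
have [LW W0 [Phi HPhi]] := hW.
(* A finite supremum bounds the H^2 norms for all nonnegative times. *)
apply: contrapT => sup.
have [M M0 WM] : exists2 M : R, 0 < M &
    forall t, 0 <= t -> (H2norm (W t) < M%:E)%E.
  move: sup; set A := [set _ | _ in _] => sup.
  have ub t : 0 <= t -> (H2norm (W t) <= ereal_sup A)%E.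
    by move=> t0; apply: ereal_sup_ubound; exists t.
  case E : (ereal_sup A) sup ub => [s||] sup ub; last 2 first.
  - by case: sup.
  - by exists 1 => // t /ub; rewrite leeNy_eq => /eqP ->; rewrite ltNyr.
  exists (`|s| + 1); first by rewrite ltr_wpDl.
  move=> t /ub /le_lt_trans; apply.
  by rewrite lte_fin (le_lt_trans (ler_norm s))// ltrDl.
have [q qE] : exists q : R -> (R -> R) * (R -> R), forall t, 0 <= t ->
    [/\ H2_bounded (q t).1 (2 * M), H2_bounded (q t).2 (2 * M),
    {ae lebesgue_measure, forall y, `[0%R : R, 1%R : R]%classic y ->
       complex.Re (W t y) = (q t).1 y} &
    {ae lebesgue_measure, forall y, `[0%R : R, 1%R : R]%classic y ->
       complex.Im (W t y) = (q t).2 y}].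
  have /choice[q qE] : forall t, exists q : (R -> R) * (R -> R), 0 <= t ->
    [/\ H2_bounded q.1 (2 * M), H2_bounded q.2 (2 * M),
    {ae lebesgue_measure, forall y, `[0%R : R, 1%R : R]%classic y ->
       complex.Re (W t y) = q.1 y} &
    {ae lebesgue_measure, forall y, `[0%R : R, 1%R : R]%classic y ->
       complex.Im (W t y) = q.2 y}].
    move=> t; have [t0|t0] := leP 0 t; last by exists (cst 0, cst 0).
    have [P [Q PQ]] := H2norm_representatives M0 (WM _ t0).
    by exists (P, Q).
  by exists q.
have Hr t : 0 <= t -> H2_bounded (q t).1 (2 * M) by move=> /qE[].
have Hi t : 0 <= t -> H2_bounded (q t).2 (2 * M) by move=> /qE[].
have Hac P : H2_bounded P (2 * M) -> exists p, ac P p by move=> [p [? []]]; exists p.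
have Hm t : 0 <= t -> mode r (k * t) (q t).1 (q t).2
    (fun y => complex.Re (Phi t y)) (fun y => complex.Im (Phi t y)).
  move=> t0; have [H1 H2 E1 E2] := qE t t0; have [SF _] := HPhi t.
  have [p1 a1] := Hac _ H1; have [p2 a2] := Hac _ H2.
  apply: (stream_function_mode k0 g0 _ ar _ _ E1 E2 SF).
  - by move=> y _; exact: rE.
  - exact: ac_measurable a1.
  - exact: ac_measurable a2.
have LPhi t : L2 (Phi t).
  by have [[_ _ _ [Phi1 [v1 /= [LP _ _ _ _]]]] _] := HPhi t.
have dW h t (hI : 0 <= h <= 1) := euler_derivatives hI af LW (LPhi t) (HPhi t).2.
have JE p h (P : R -> R) : L1 p -> H2_bounded P (2 * M) -> 0 <= h <= 1 ->
    {ae lebesgue_measure, forall y, `[0%R : R, 1%R : R]%classic y -> p y = P y} ->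
    itg 0 h p = itg 0 h P.
  move=> Ip /Hac[p' aP] /andP[_ h1] pP; apply: eq_itg_ae => //.
    exact: L1_measurable.
  exact: ac_measurable aP.
have zr : (q 0).1 0 = 0.
  apply: (no_bounded_evolution ar ar1 S0 r0 k0 af _ fL Hr Hi Hm
    (J := fun h t => itg 0 h (fun y => complex.Re (W t y)))).
  - exact/eqP.
  - move=> h t hI t0; have [H1 _ E1 _] := qE t t0.
    exact: JE (L2_L1 (LW t)).1 H1 hI E1.
  - by move=> h t hI _; exact: (dW h t hI).1.
(* The imaginary part is the real part of [- i W]. *)
have zi : (q 0).2 0 = 0.
  apply: (no_bounded_evolution ar ar1 S0 r0 k0 af _ fL Hi _
    (fun t t0 => mode_mulNi (Hm t t0))
    (J := fun h t => itg 0 h (fun y => complex.Im (W t y)))).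
  - exact/eqP.
  - by move=> t t0; exact: H2_boundedN (Hr t t0).
  - move=> h t hI t0; have [_ H2 _ E2] := qE t t0.
    exact: JE (L2_L1 (LW t)).2 H2 hI E2.
  - by move=> h t hI _; exact: (dW h t hI).2.
have [H1 H2 E1 E2] := qE 0 (lexx 0).
have [[cR cI] _] := hw0.
have [p1 a1] := Hac _ H1; have [p2 a2] := Hac _ H2.
have wR : complex.Re (w0 0) = 0.
  rewrite -[RHS]zr; apply: (ae_eq_continuous cR (ac_cont a1) _ I0).
  by apply: ae_imp2 W0 E1 => y + + yI => <- // <-.
have wI : complex.Im (w0 0) = 0.
  rewrite -[RHS]zi; apply: (ae_eq_continuous cI (ac_cont a2) _ I0).
  by apply: ae_imp2 W0 E2 => y + + yI => <- // <-.
by apply: hw00; move: wR wI; case: (w0 0) => a b /= -> ->.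
Qed.
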